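(* The mock Alexander polynomial $\nabla^{\sharp}_K$ is an invariant of knotoids in $S^2$; that is, if $K$ and $K'$ are equivalent knotoid diagrams in $S^2$, then $\nabla^{\sharp}_K(W)=\nabla^{\sharp}_{K'}(W)$.
   Context: A knotoid diagram in $S^2$ is a generic immersion of the unit interval $[0,1]$ in $S^2$ with finitely many transverse double points, each carrying over/under information (crossings); the two endpoints (the tail, image of $0$, and the head, image of $1$) are distinct from each other and from the crossings, and the diagram is oriented from tail to head. Two knotoid diagrams are equivalent if they are related by isotopy of $S^2$ and finitely many Reidemeister moves RI, RII, RIII performed away from the endpoints (an endpoint may not be pulled across an arc). A knotoid is an equivalence class of knotoid diagrams. The universe of a diagram is the graph obtained by turning crossings into 4-valent vertices and endpoints into 1-valent vertices; regions are the connected components of its complement. A knotoid diagram in $S^2$ with $n$ crossings has $n+1$ regions. Labels. At each crossing there are four local regions (corners): the out-corner (between the two outgoing edges), the in-corner (between the two incoming edges) and two side corners. At a positive crossing the out-corner has label $W$, the in-corner $-W^{-1}$, and both side corners $1$. At a negative crossing the out-corner has label $W^{-1}$, the in-corner $-W$, and both side corners $1$. Place a star on the region adjacent to the tail of $K$. A state assigns to every unstarred region one marker, placed at a corner of that region at a crossing, so that every crossing receives exactly one marker (if a region occupies several corners at one crossing, different corners give different states). The weight of a state is the product of the labels of the marked corners, and $\nabla^{\sharp}_K(W)$ is the sum of the weights of all states. *)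

(* Defs.v *)
From Stdlib Require Export Relations.
From mathcomp Require Export all_boot all_order all_algebra.
Set Implicit Arguments.
Unset Strict Implicit.
Unset Printing Implicit Defensive.

(** Knotoid diagrams in S^2, up to isotopy of S^2, encoded by signed Gauss
    codes.

    The universe of a knotoid diagram is connected, so its complement in S^2
    consists of discs and the diagram is determined, up to isotopy of the
    oriented sphere, by the cyclic order of the half-edges at each crossing
    together with the over/under data. All of this is recorded by the list of
    the passages through crossings met when walking from tail to head, each
    with the name of the crossing, whether the walk goes over or under there,
    and the sign of the crossing. A code comes from a diagram in S^2 if and
    only if the surface obtained by gluing discs along its regions has Euler
    characteristic 2. *)

(* ((crossing name, over?), positive?) *)
Definition passage : Type := (nat * bool * bool)%type.
Definition code : Type := seq passage.

Definition name (p : passage) : nat := p.1.1.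
Definition over (p : passage) : bool := p.1.2.
Definition positive (p : passage) : bool := p.2.

Definition other (p : passage) : passage := (name p, ~~ over p, positive p).

(* Each crossing is passed exactly twice, once over and once under, and both
   passages record the same sign. *)
Definition gauss_code (w : code) : bool :=
  uniq w &&
  all (fun p => (other p \in w) &&
                all (fun q => (name q == name p) ==> (q \in [:: p; other p])) w)
      w.

Section Code.

Variable w : code.

Definition crossing : finType := seq_sub [seq name p | p <- w].

Definition over_pos (c : nat) : nat :=
  find (fun p => (name p == c) && over p) w.
Definition under_pos (c : nat) : nat :=
  find (fun p => (name p == c) && ~~ over p) w.
Definition sign (c : nat) : bool :=
  has (fun p => (name p == c) && positive p) w.

(* The edges are numbered from 0 (at the tail) to size w (at the head); the
   passage at position i of w enters its crossing along edge i and leaves it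
   along edge i.+1. A side of an edge is (edge, true) on the left of the
   oriented edge and (edge, false) on its right. *)
Definition side : finType := ('I_(size w).+1 * bool)%type.
Definition mk_side (e : nat) (left : bool) : side := (inord e, left).

(* The corner (c, (a, b)) of the crossing c lies between a half-edge of the
   over strand, outgoing if a and incoming otherwise, and a half-edge of the
   under strand, outgoing if b and incoming otherwise. So (true, true) is the
   out-corner, (false, false) the in-corner, and the two others are the side
   corners. *)
Definition corner : finType := (crossing * (bool * bool))%type.

(* The two sides of edges bounding a corner near its crossing. At a positive
   crossing the under strand crosses the over strand from right to left, so
   that its outgoing half-edge is on the left of the over strand. *)
Definition over_side (k : corner) : side :=
  let: (c, (a, b)) := k in
  mk_side (over_pos (val c) + a) (b == sign (val c)).
Definition under_side (k : corner) : side :=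
  let: (c, (a, b)) := k in
  mk_side (under_pos (val c) + b) (a != sign (val c)).

(* Two sides of edges are adjacent if they follow each other along the
   boundary of a region: at a corner, or around one of the endpoints. *)
Definition adjacent (x y : side) : bool :=
  [|| [exists k : corner, ((x, y) == (over_side k, under_side k))
                       || ((y, x) == (over_side k, under_side k))],
      (x.1 == y.1) && (val x.1 == 0)
    | (x.1 == y.1) && (val x.1 == size w)].

(* A region is identified with the set of sides of edges on its boundary. *)
Definition region_of (x : side) : {set side} :=
  [set y | connect adjacent x y].
Definition regions : {set {set side}} := [set region_of x | x : side].

(* V + F = E + 2, where the vertices of the universe are the crossings and the
   two endpoints. *)
Definition spherical : bool :=
  #|crossing| + 2 + #|regions| == #|'I_(size w).+1| + 2.

Definition region_at (k : corner) : {set side} := region_of (over_side k).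

Definition starred : {set side} := region_of (mk_side 0 true).

(* A state is identified with the set of its marked corners. *)
Definition is_state (S : {set corner}) : bool :=
  [forall c : crossing, #|[set k in S | k.1 == c]| == 1] &&
  [forall r in regions,
     #|[set k in S | region_at k == r]| == (if r == starred then 0 else 1)].

Import GRing.Theory.
Local Open Scope ring_scope.

(* The ring of Laurent polynomials Z[W, W^-1] is taken inside the field of
   fractions of Z[W]. *)
Definition W : {fraction {poly int}} := FracField.tofrac 'X.

Definition label (k : corner) : {fraction {poly int}} :=
  match sign (val k.1), k.2 with
  | true,  (true, true)   => W
  | true,  (false, false) => - W^-1
  | false, (true, true)   => W^-1
  | false, (false, false) => - W
  | _, _                  => 1
  end.

Definition nabla : {fraction {poly int}} :=
  \sum_(S : {set corner} | is_state S) \prod_(k in S) label k.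

End Code.

Record knotoid_diagram : Type := KnotoidDiagram {
  code_of :> code;
  code_of_gauss : gauss_code code_of;
  code_of_spherical : spherical code_of
}.

(* Two diagrams with the same code up to the names of the crossings are
   isotopic in S^2. *)
Definition isotopic (w w' : code) : Prop :=
  exists2 f : nat -> nat, injective f &
    w' = [seq (f (name p), over p, positive p) | p <- w].

(* Removal of a kink: the edge between the two passages bounds a monogon. *)
Definition RI (w w' : code) : Prop :=
  exists w0 w1 : code, exists p : passage,
    w = w0 ++ [:: p; other p] ++ w1 /\ w' = w0 ++ w1.

(* Removal of a bigon region, one strand of which is over (or under) at both
   of its crossings. *)
Definition RII (w w' : code) : Prop :=
  exists w0 w1 w2 : code, exists p1 p2 q1 q2 : passage, exists s t : bool,
    let x := mk_side w (size w0).+1 s in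
    let y := mk_side w (size w0 + size w1 + 3) t in
    [/\ w = w0 ++ [:: p1; p2] ++ w1 ++ [:: q1; q2] ++ w2,
        over p1 = over p2,
        region_of x = [set x; y]
      & w' = w0 ++ w1 ++ w2].

(* Passing a strand across the opposite crossing of a triangular region: along
   each of the three strands the order of the two crossings is reversed. One
   strand has to be over at both its crossings, and another one under at both
   its crossings. *)
Definition RIII (w w' : code) : Prop :=
  exists w0 w1 w2 w3 : code, exists p1 p2 q1 q2 r1 r2 : passage,
  exists s t u : bool,
    let x := mk_side w (size w0).+1 s in
    let y := mk_side w (size w0 + size w1 + 3) t in
    let z := mk_side w (size w0 + size w1 + size w2 + 5) u in
    [/\ w = w0 ++ [:: p1; p2] ++ w1 ++ [:: q1; q2] ++ w2 ++ [:: r1; r2] ++ w3,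
        [|| over p1 && over p2, over q1 && over q2 | over r1 && over r2],
        [|| ~~ over p1 && ~~ over p2, ~~ over q1 && ~~ over q2
          | ~~ over r1 && ~~ over r2],
        region_of x = [set x; y; z]
      & w' = w0 ++ [:: p2; p1] ++ w1 ++ [:: q2; q1] ++ w2 ++ [:: r2; r1] ++ w3].

Definition move (D D' : knotoid_diagram) : Prop :=
  [\/ isotopic D D', RI D D', RII D D' | RIII D D'].

Definition equivalent : knotoid_diagram -> knotoid_diagram -> Prop :=
  clos_refl_sym_trans knotoid_diagram move.

Definition mock_alexander (D : knotoid_diagram) : {fraction {poly int}} :=
  nabla D.

(* Main.v *)
(* A state sum is a permanent: every crossing picks a corner, so that the chosen
   regions are distinct and unstarred. A diagram with n crossings has n + 1
   regions, so a sum in which the n crossings (and the star) have at most n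
   regions left vanishes by the pigeonhole principle. Expanding along the
   crossings of a move, this forces one of them to mark the monogon, bigon or
   triangle, and what remains is an identity between products of labels.

   The regions of the other diagram of a move are described by a colouring of
   the sides of its edges which is constant along the corners. Such a colouring
   always factors through the regions, so by counting it separates them as soon
   as it takes n + 1 values. In the second move, this same count (where the
   sphericity of both diagrams is used) shows that the two regions merged by
   the move are distinct. *)

Require Import Defs.
From mathcomp Require Import ring zify.
Set Implicit Arguments.
Unset Strict Implicit.
Unset Printing Implicit Defensive.

Import GRing.Theory.
Local Open Scope ring_scope.

(** * Permanent state sums *)

(** Regions are classes of a transitive closure, so following them through a move directly would
    mean surgery on paths. A colouring is checked corner by corner instead. The moves prescribe
    positions in a word and the boundary of one face, but neither the relative directions of the
    strands nor the pairing of their passages; both are recovered by turning around the corners of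
    that face. Corners are therefore described relative to a strand, so that over/under information
    enters the labels only through signs. The label identities have these sources. A monogon faces a
    side corner, of label $1$. The two crossings of a bigon have opposite signs, so the
    contributions of the regions across its sides cancel, while the two regions at its tips get
    coefficient $1$; their sum is the state sum of the merged diagram by inclusion-exclusion. Around
    a triangle, six outer regions give fifteen pairs, and the coefficients agree pair by pair when
    the over/under pattern is not cyclic. *)

Lemma perm_cons2 (T : eqType) (x y : T) s : perm_eq [:: x, y & s] [:: y, x & s].
Proof. by apply/permPl/(perm_catCA [:: x] [:: y]). Qed.

Section StateSum.
Variables (F : comNzRingType) (T : eqType).
Implicit Types (v : seq (F * T)) (vs : seq (seq (F * T))) (used : seq T).

(* Each vertex lists the labels and the regions of its corners. *)
Fixpoint statesum vs used : F :=
  if vs is v :: vs' then \sum_(m <- v) m.1 * statesum vs' (m.2 :: used)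
  else (uniq used)%:R.

Lemma statesum_perm_used vs used used' :
  perm_eq used used' -> statesum vs used = statesum vs used'.
Proof.
elim: vs used used' => [|v vs IH] used used' uu' /=.
  by rewrite (perm_uniq uu').
by apply: eq_bigr => m _; rewrite (IH _ (m.2 :: used')) // perm_cons.
Qed.

Lemma statesum_nuniq vs used : ~~ uniq used -> statesum vs used = 0.
Proof.
elim: vs used => [|v vs IH] used nu /=; first by rewrite (negPf nu).
by apply: big1 => m _; rewrite IH ?mulr0 //= negb_and nu orbT.
Qed.

Lemma statesum_cons_perm v v' vs used :
  perm_eq v v' -> statesum (v :: vs) used = statesum (v' :: vs) used.
Proof. by move=> vv'; rewrite /= (perm_big _ vv'). Qed.

Lemma statesum_congr v v' vs vs' used : perm_eq v v' ->
  statesum vs =1 statesum vs' ->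
  statesum (v :: vs) used = statesum (v' :: vs') used.
Proof.
move=> vv' vsE; rewrite /= (perm_big _ vv') /=.
by apply: eq_bigr => m _; rewrite vsE.
Qed.

Lemma statesum_map_perm (I : eqType) (f g : I -> seq (F * T)) (D : seq I) used :
  {in D, forall i, perm_eq (f i) (g i)} ->
  statesum (map f D) used = statesum (map g D) used.
Proof.
elim: D used => [//|i D IH] used fg.
rewrite (@statesum_cons_perm _ (g i)) ?fg ?mem_head //=.
apply: eq_bigr => m _; rewrite IH // => k kD; apply: fg.
by rewrite inE kD orbT.
Qed.

Lemma statesum_swap v1 v2 vs used :
  statesum [:: v1, v2 & vs] used = statesum [:: v2, v1 & vs] used.
Proof.
rewrite /=; under eq_bigr do rewrite big_distrr.
rewrite exchange_big /=; apply: eq_bigr => m2 _.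
rewrite big_distrr; apply: eq_bigr => m1 _ /=.
rewrite mulrCA; congr (_ * (_ * _)); apply: statesum_perm_used.
exact: perm_cons2.
Qed.

Lemma statesum_perm vs vs' used :
  perm_eq vs vs' -> statesum vs used = statesum vs' used.
Proof.
have mid v s1 s2 u : statesum (s1 ++ v :: s2) u = statesum (v :: s1 ++ s2) u.
  elim: s1 u => [//|v1 s1 IH] u; rewrite [RHS]statesum_swap cat_cons.
  by rewrite [LHS]/= [RHS]/=; apply: eq_bigr => m _; rewrite IH.
elim: vs vs' used => [|v vs IH] vs' used.
  by rewrite perm_sym => /perm_nilP ->.
move=> pvv'; have vv' : v \in vs' by rewrite -(perm_mem pvv') mem_head.
case/splitPr: vs' / vv' pvv' => s1 s2 pvv'; rewrite mid [LHS]/= [RHS]/=.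
apply: eq_bigr => m _; congr (_ * _); apply: IH.
by move: pvv'; rewrite perm_sym -(cat1s v s2) perm_catCA perm_cons perm_sym.
Qed.

Definition occurs (d : T) vs := has (fun v => d \in map snd v) vs.

(** A region that no remaining corner touches imposes no constraint. This applies to the face of a
    move once one of its crossings has marked it. *)
Lemma statesum_avoid d vs used :
  ~~ occurs d vs -> d \notin used ->
  statesum vs (d :: used) = statesum vs used.
Proof.
elim: vs used => [|v vs IH] used /=; first by move=> _ ->.
rewrite negb_or => /andP [dv dvs] du.
apply: eq_big_seq => m mv.
rewrite (@statesum_perm_used _ _ [:: d, m.2 & used]); last first.
  exact: perm_cons2.
rewrite IH // inE negb_or du andbT.
by apply: contraNneq dv => ->; apply: map_f.
Qed.

Lemma statesum_pigeonhole (rs : seq T) vs used :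
  all (fun v => all (fun m => m.2 \in rs) v) vs -> {subset used <= rs} ->
  (size rs < size vs + size used)%N -> statesum vs used = 0.
Proof.
elim: vs used => [|v vs IH] used /=.
  move=> _ urs; case: (boolP (uniq used)) => // uu.
  by rewrite ltnNge (uniq_leq_size uu urs).
case/andP=> /allP vrs vsrs urs sz.
rewrite big_seq_cond big1 // => m; rewrite andbT => mv.
rewrite IH ?mulr0 //=; last by rewrite addnS.
by move=> x; rewrite inE => /predU1P [->|/urs //]; apply: vrs.
Qed.

(** * Identifying two regions *)

Section Merge.
Variables (l r : T).
Hypothesis lr : l != r.

Definition merge (x : T) := if x == r then l else x.
Definition merge_vertex v := [seq (m.1, merge m.2) | m <- v].

Lemma merge_id x : x != r -> merge x = x.
Proof. by rewrite /merge => /negPf ->. Qed.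

(** Once the merged region is taken, no further marker may lie in [l] or in [r]. *)
Lemma statesum_merge_used vs used : l \notin used -> r \notin used ->
  statesum (map merge_vertex vs) (l :: used) = statesum vs [:: l, r & used].
Proof.
elim: vs used => [|v vs IH] used lu ru /=.
  by rewrite inE negb_or lr lu ru.
rewrite big_map; apply: eq_bigr => m _; congr (_ * _) => /=.
rewrite /merge; have [->|mr] := eqVneq m.2 r.
  by rewrite !statesum_nuniq //= !inE eqxx ?orbT.
have [->|ml] := eqVneq m.2 l.
  by rewrite !statesum_nuniq //= !inE eqxx ?orbT.
rewrite (@statesum_perm_used _ _ [:: l, m.2 & used]); last first.
  exact: perm_cons2.
rewrite IH ?inE ?negb_or ?lu ?ru ?andbT 1?eq_sym //.
apply: statesum_perm_used; exact/permPl/(perm_catCA [:: l; r] [:: m.2]).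
Qed.

(** Inclusion-exclusion: a marking survives the merging when it leaves [l] or [r] empty, and the
    markings leaving both empty are counted twice on the right. *)
Lemma statesum_merge vs used : l \notin used -> r \notin used ->
  statesum (map merge_vertex vs) used + statesum vs [:: l, r & used] =
  statesum vs (l :: used) + statesum vs (r :: used).
Proof.
elim: vs used => [|v vs IH] used lu ru /=.
  by rewrite inE negb_or lr lu ru.
rewrite big_map -!big_split /=; apply: eq_bigr => m _ /=.
rewrite -!mulrDr; congr (_ * _).
rewrite /merge; have [->|mr] := eqVneq m.2 r.
  rewrite statesum_merge_used //.
  rewrite [X in _ + X = _]statesum_nuniq ?[X in _ = _ + X]statesum_nuniq //=;
    rewrite ?inE ?eqxx ?orbT //.
  rewrite !addr0; apply: statesum_perm_used; exact: perm_cons2.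
have [->|ml] := eqVneq m.2 l.
  rewrite statesum_merge_used //.
  rewrite [X in _ + X = _]statesum_nuniq ?[X in _ = X + _]statesum_nuniq //=;
    rewrite ?inE ?eqxx ?orbT //.
  by rewrite addr0 add0r.
have pm a s : perm_eq [:: m.2, a & s] [:: a, m.2 & s].
  exact: perm_cons2.
have pm2 : perm_eq [:: m.2, l, r & used] [:: l, r, m.2 & used].
  exact/permPl/(perm_catCA [:: m.2] [:: l; r]).
rewrite (statesum_perm_used _ pm2) !(statesum_perm_used _ (pm _ _)).
by rewrite IH // inE negb_or ?lu ?ru andbT eq_sym.
Qed.

End Merge.
End StateSum.

(** * The labels around a monogon, a bigon and a triangle *)

Section Local.
Variables (F : fieldType) (T : eqType) (W : F).
Hypothesis W0 : W != 0.
Variables (vs : seq (seq (F * T))) (rs : seq T) (d star : T).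
Hypothesis vs_rs : all (fun v => all (fun m => m.2 \in rs) v) vs.
Hypothesis d_rs : d \notin rs.
Hypothesis star_rs : star \in rs.

Definition corner_label (pos a b : bool) : F :=
  match pos, (a, b) with
  | true,  (true, true)   => W
  | true,  (false, false) => - W^-1
  | false, (true, true)   => W^-1
  | false, (false, false) => - W
  | _, _                  => 1
  end.

Lemma avoid_d used : {subset used <= rs} ->
  statesum vs (d :: used) = statesum vs used.
Proof.
move=> urs; apply: statesum_avoid; last by apply: (contraNN (@urs d) d_rs).
apply/hasPn => v /(allP vs_rs) /allP vrs.
by apply/mapP => -[m /vrs mrs dm]; move: d_rs; rewrite dm mrs.
Qed.

(** If the kink marks another corner, that region, the star and one region per vertex of [vs] would
    be [size vs + 2] distinct elements of [rs]. *)
Lemma statesum_monogon v : all (fun m => m.2 \in rs) v ->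
  (size rs <= (size vs).+1)%N ->
  statesum (((1, d) :: v) :: vs) [:: star] = statesum vs [:: star].
Proof.
move=> /allP vrs sz; rewrite /= big_cons big_seq big1 => [|m mv].
  by rewrite addr0 mul1r avoid_d // => x; rewrite inE => /eqP ->.
rewrite (@statesum_pigeonhole _ _ rs) ?mulr0 //= ?addn2 //.
by move=> x; rewrite !inE => /orP [] /eqP -> //; apply: vrs.
Qed.

(** The regions [l] and [r] lie at the tips of the bigon [d], and [t] and [u] across its sides.
    Exactly one of the two crossings marks [d]; the hypotheses on the labels compute the coefficient
    of each region left to the other crossing. *)
Lemma statesum_bigon (l r t u : T) (d1 l1 t1 u1 d2 r2 t2 u2 : F) :
  all (mem rs) [:: l; r; t; u] -> l != r -> (size rs <= (size vs).+2)%N ->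
  d1 * r2 = 1 -> d2 * l1 = 1 ->
  d1 * t2 + d2 * t1 = 0 -> d1 * u2 + d2 * u1 = 0 ->
  statesum ([:: (d1, d); (t1, t); (u1, u); (l1, l)]
         :: [:: (d2, d); (t2, t); (u2, u); (r2, r)] :: vs) [:: star] =
  statesum (map (merge_vertex l r) vs) [:: merge l r star].
Proof.
move=> /and5P [lrs rrs trs urs _] lr sz dr dl dt du.
have dd : statesum vs [:: d; d; star] = 0.
  by apply: statesum_nuniq; rewrite /= mem_head.
have sub2 x : x \in rs -> {subset [:: x; star] <= rs}.
  by move=> xrs y; rewrite !inE => /orP [] /eqP ->.
have dx x : x \in rs -> statesum vs [:: d; x; star] = statesum vs [:: x; star].
  by move=> /sub2 /avoid_d.
have xd x : x \in rs -> statesum vs [:: x; d; star] = statesum vs [:: x; star].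
  by move=> xrs; rewrite (statesum_perm_used _ (perm_cons2 _ _ _)) dx.
have xy x y : x \in rs -> y \in rs -> statesum vs [:: x; y; star] = 0.
  move=> xrs yrs; apply: (@statesum_pigeonhole _ _ rs) => //=.
    by move=> z; rewrite !inE => /or3P [] /eqP ->.
  by rewrite addn3.
rewrite /= !(big_cons, big_nil) /= dd !(dx, xd) // !xy //.
transitivity (statesum vs [:: l; star] + statesum vs [:: r; star]).
  set x := statesum vs [:: l; _]; set y := statesum vs [:: r; _].
  set z := statesum vs [:: t; _]; set a := statesum vs [:: u; _].
  transitivity (d1 * r2 * y + d2 * l1 * x + (d1 * t2 + d2 * t1) * z
              + (d1 * u2 + d2 * u1) * a); first by ring.
  by rewrite dr dl dt du; ring.
(* If the star is in one of the merged regions, one of the two terms vanishes and the merged region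
   is the starred one. *)
have [sl|sl] := eqVneq star l.
  rewrite sl merge_id // [X in X + _]statesum_nuniq ?mem_head //= ?inE ?eqxx //.
  rewrite add0r statesum_merge_used //.
  exact/statesum_perm_used/perm_cons2.
have [sr|sr] := eqVneq star r.
  rewrite sr /merge eqxx [X in _ + X]statesum_nuniq /= ?inE ?eqxx //.
  by rewrite addr0 (statesum_merge_used lr).
(* The correction term of the inclusion-exclusion takes [l], [r] and the star out of [rs], which
   leaves fewer regions than vertices. *)
rewrite merge_id // -(statesum_merge lr) ?inE 1?eq_sym // xy //.
by rewrite addr0.
Qed.

(** [Ei] is the region across the side on strand [i], and [Vij] the region opposite to the triangle
    at the crossing of [i] and [j]. The boolean [yi] tells whether strand [i] meets the following
    one at its second passage; [eij] and [oij] are [eps] and [over] of that passage. Each of the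
    three equations says that the triangle lies on the same side of a strand at both its
    crossings. *)
Lemma statesum_triangle (y1 y2 y3 e12 e23 e31 o12 o23 o31 : bool)
    (E1 E2 E3 V12 V23 V31 : T) :
  let V pos a b d p q v :=
    [:: (corner_label pos (~~ a) b, d); (corner_label pos (~~ a) (~~ b), p);
        (corner_label pos a b, q); (corner_label pos a (~~ b), v)] in
  all (mem rs) [:: E1; E2; E3; V12; V23; V31] ->
  (size rs <= (size vs).+3)%N ->
  (y2 == e12) = (y3 == e31) -> (y3 == e23) = (y1 == e12) ->
  (y1 == e31) = (y2 == e23) ->
  ~~ [&& o12, o23 & o31] -> [|| o12, o23 | o31] ->
  statesum [:: V (o12 == e12) y1 y2 d E1 E2 V12,
               V (o23 == e23) y2 y3 d E2 E3 V23,
               V (o31 == e31) y3 y1 d E3 E1 V31 & vs] [:: star] =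
  statesum [:: V (o12 == e12) y1 y2 E3 V31 V23 d,
               V (o23 == e23) y2 y3 E1 V12 V31 d,
               V (o31 == e31) y3 y1 E2 V23 V12 d & vs] [:: star].
Proof.
move=> V; rewrite /V.
case/and5P=> E1rs E2rs E3rs V12rs /and3P [V23rs V31rs _] sz.
have ddx x : statesum vs [:: d; d; x; star] = 0.
  by apply: statesum_nuniq; rewrite /= mem_head.
have dxd x : statesum vs [:: d; x; d; star] = 0.
  by apply: statesum_nuniq; rewrite /= !inE eqxx orbT.
have xdd x : statesum vs [:: x; d; d; star] = 0.
  by apply: statesum_nuniq; rewrite /= !inE eqxx andbF.
have sub3 x y : x \in rs -> y \in rs -> {subset [:: x; y; star] <= rs}.
  by move=> xrs yrs z; rewrite !inE => /or3P [] /eqP ->.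
pose G x y := statesum vs [:: x; y; star].
have dxy x y : x \in rs -> y \in rs -> statesum vs [:: d; x; y; star] = G x y.
  by move=> xrs yrs; apply/avoid_d/sub3.
have xdy x y : x \in rs -> y \in rs -> statesum vs [:: x; d; y; star] = G x y.
  by move=> xrs yrs; rewrite (statesum_perm_used _ (perm_cons2 _ _ _)) dxy.
have xyd x y : x \in rs -> y \in rs -> statesum vs [:: x; y; d; star] = G x y.
  move=> xrs yrs; rewrite -dxy //; apply: statesum_perm_used.
  exact/permPl/(perm_catCA [:: x; y] [:: d]).
have xyz x y z : x \in rs -> y \in rs -> z \in rs ->
    statesum vs [:: x; y; z; star] = 0.
  move=> xrs yrs zrs; apply: (@statesum_pigeonhole _ _ rs) => //=.
    by move=> a; rewrite inE => /predU1P [->|/(sub3 _ _ yrs zrs)].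
  by rewrite addn4.
have Gxx x : G x x = 0 by apply: statesum_nuniq; rewrite /= mem_head.
have GC x y : G x y = G y x by apply/statesum_perm_used/perm_cons2.
rewrite /= !(big_cons, big_nil) /=.
rewrite !(ddx, dxd, xdd) !(dxy, xdy, xyd) // !xyz //.
(* Ordering the arguments of [G] leaves one unknown for each of the fifteen unordered pairs of outer
   regions; both sides are then linear forms in these unknowns. *)
rewrite !Gxx ?(GC _ E1) ?(GC E3 E2) ?(GC V12 E2) ?(GC V23 E2) ?(GC V31 E2).
rewrite ?(GC V12 E3) ?(GC V23 E3) ?(GC V31 E3).
rewrite ?(GC V23 V12) ?(GC V31 V12) ?(GC V31 V23).
rewrite !(mulr0, addr0, add0r).
clearbody G; clear ddx dxd xdd sub3 dxy xdy xyd xyz Gxx GC V.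
do 15! (move: (G _ _) => ?).
case: y1; case: y2; case: y3; case: e12; case: e23; case: e31 => // _ _ _;
  case: o12; case: o23; case: o31 => // _ _; rewrite /corner_label /=; by field.
Qed.
End Local.

(** * States as injective markings *)

Section Markings.
Variables (F : comNzRingType) (T : eqType) (C B : finType).
Variables (lab : C * B -> F) (reg : C * B -> T).
Implicit Types (S : {set C * B}) (cs : seq C) (used : seq T).

Definition marking cs used S :=
  [&& [forall c, #|[set k in S | k.1 == c]| == (c \in cs)],
      [forall k in S, reg k \notin used]
    & [forall k in S, forall l in S, (reg k == reg l) ==> (k == l)]].

Lemma markingP cs used S :
  reflect [/\ forall c, #|[set k in S | k.1 == c]| = (c \in cs),
              {in S, forall k, reg k \notin used} & {in S &, injective reg}]
          (marking cs used S).
Proof.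
apply: (iffP and3P) => -[h1 h2 h3]; split.
- by move=> c; apply/eqP; move/forallP: h1.
- by move=> k kS; move/forall_inP: h2 => ->.
- move=> k l kS lS kl; apply/eqP.
  by move/forall_inP: h3 => /(_ k kS) /forall_inP /(_ l lS); rewrite kl eqxx.
- by apply/forallP => c; rewrite h1.
- by apply/forall_inP.
- apply/forall_inP => k kS; apply/forall_inP => l lS; apply/implyP => /eqP.
  by move/(h3 _ _ kS lS) => ->.
Qed.

(** One step of the expansion: removing the marker of [c] turns its region into a forbidden one. *)
Lemma marking_cons c m cs used S : c \notin cs ->
  reg (c, m) \notin used -> (c, m) \notin S ->
  marking (c :: cs) used ((c, m) |: S) = marking cs (reg (c, m) :: used) S.
Proof.
move=> ccs mused mS.
have cardE c' : #|[set k in (c, m) |: S | k.1 == c']|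
    = ((c == c') + #|[set k in S | k.1 == c']|)%N.
  have [<-|cc'] := eqVneq c c'.
    transitivity #|(c, m) |: [set k in S | k.1 == c]|.
      apply: eq_card => k; rewrite !inE.
      by have [->|] //= := eqVneq k (c, m); rewrite eqxx.
    by rewrite cardsU1 !inE (negPf mS).
  rewrite add0n; apply: eq_card => k; rewrite !inE.
  by have [->|] //= := eqVneq k (c, m); rewrite (negPf cc') andbF.
apply/markingP/markingP => -[h1 h2 h3]; split.
- move=> c'; have := h1 c'; rewrite cardE inE eq_sym.
  by case: (eqVneq c' c) => [->|_] //=; rewrite (negPf ccs) => -[].
- move=> k kS; rewrite inE negb_or h2 ?inE ?kS ?orbT // andbT.
  apply: contraNneq mS => /h3 e; rewrite -e ?inE ?kS ?eqxx ?orbT //.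
- by move=> k l kS lS; apply: h3; rewrite !inE ?kS ?lS orbT.
- move=> c'; rewrite cardE h1 inE eq_sym.
  by case: (eqVneq c' c) => [->|_] //=; rewrite (negPf ccs).
- move=> k; rewrite !inE => /predU1P [->//|/h2].
  by rewrite inE negb_or => /andP [].
- move=> k l; rewrite !inE => /predU1P [->|kS] /predU1P [->|lS] // kl.
  + by have := h2 _ lS; rewrite inE negb_or kl eqxx.
  + by have := h2 _ kS; rewrite inE negb_or kl eqxx.
  + exact: h3.
Qed.

Lemma sum_markings cs used : uniq cs -> uniq used ->
  \sum_(S | marking cs used S) \prod_(k in S) lab k =
  statesum [seq [seq (lab (c, m), reg (c, m)) | m <- enum B] | c <- cs] used.
Proof.
elim: cs used => [|c cs IH] used /=.
  move=> _ ->; rewrite (big_pred1 set0) ?big_set0 // => S.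
  apply/markingP/eqP => [[h _ _]|->].
    apply/setP => -[c b]; rewrite inE; apply/negP => bS.
    have /eqP := h c; rewrite cards_eq0 => /eqP /setP /(_ (c, b)).
    by rewrite !inE bS eqxx.
  split=> [c|k|k l]; rewrite ?inE //.
  by apply/eqP; rewrite cards_eq0; apply/eqP/setP => k; rewrite !inE.
move=> /andP [ccs ucs] uused; rewrite big_map big_enum /=.
have markE S : marking (c :: cs) used S ->
    exists m0, forall m, ((c, m) \in S) = (m == m0).
  case/markingP => /(_ c) /eqP; rewrite mem_head => /cards1P [k /setP kP] _ _.
  have := kP k; rewrite !inE eqxx => /andP [_ /eqP kc].
  exists k.2 => m; have := kP (c, m); rewrite !inE eqxx andbT => ->.
  by rewrite {1}(surjective_pairing k) kc xpair_eqE eqxx.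
transitivity (\sum_m \sum_(S | marking (c :: cs) used S && ((c, m) \in S))
                 \prod_(k in S) lab k).
  rewrite (exchange_big_dep (marking (c :: cs) used)) /=; last first.
    by move=> m S _ /andP [].
  apply: eq_bigr => S mS; have [m0 m0P] := markE S mS.
  by rewrite (big_pred1 m0) // => m; rewrite mS m0P.
apply: eq_bigr => m _.
have [mused|mused] := boolP (reg (c, m) \in used).
  rewrite statesum_nuniq ?mulr0 /= ?mused // big_pred0 // => S.
  apply/negP => /andP [/markingP [_ h _] /h].
  by rewrite mused.
rewrite -IH //= ?mused // big_distrr /=.
rewrite (reindex_onto (fun S => (c, m) |: S) (fun S => S :\ (c, m))) /=; last first.
  by move=> S /andP [_ mS]; rewrite setD1K.
have condE S : (marking (c :: cs) used ((c, m) |: S) && ((c, m) \in (c, m) |: S))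
    && (((c, m) |: S) :\ (c, m) == S) = marking cs (reg (c, m) :: used) S.
  rewrite setU11 andbT; have [mS|mS] := boolP ((c, m) \in S).
    rewrite [RHS](_ : _ = false); last first.
      by apply/negP => /markingP [_ h _]; have := h _ mS; rewrite mem_head.
    by rewrite andbC; case: eqP => // e; move: mS; rewrite -e setD11.
  by rewrite setU1K // eqxx andbT marking_cons.
rewrite (eq_bigl _ _ condE); apply: eq_bigr => S mS.
rewrite big_setU1 //=; apply/negP => h; case/markingP: mS => _ h' _.
by have := h' _ h; rewrite mem_head.
Qed.
End Markings.

(** * Colourings of the sides of a diagram *)

(* Relative to the strand of [p], the strand of [other p] crosses from right to
   left if and only if [eps p]; so a corner has the same description from either
   of its two strands, and over/under only matters through [eps]. *)
Definition eps (p : passage) : bool := over p == positive p.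

Lemma otherK : involutive other.
Proof. by case=> [[n o] s]; rewrite /other /= negbK. Qed.

Lemma eps_other p : eps (other p) = ~~ eps p.
Proof. by case: p => [[n []] []]. Qed.

(** * Reading a Gauss code through its passages *)

Section GaussCode.
Variable w : code.
Hypothesis gw : gauss_code w.

Lemma gauss_uniq : uniq w. Proof. by case/andP: gw. Qed.

Lemma gauss_other p : (other p \in w) = (p \in w).
Proof.
case/andP: gw => _ /allP h.
by apply/idP/idP => /h /andP [] //; rewrite otherK.
Qed.

Lemma gauss_name p q : p \in w -> q \in w -> name q = name p ->
  q = p \/ q = other p.
Proof.
case/andP: gw => _ /allP h /h /andP [_ /allP h'] /h' /implyP h'' e.
by move: h''; rewrite e eqxx !inE => /(_ isT) /orP [] /eqP; [left|right].
Qed.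

Lemma find_passage (o : bool) p : p \in w -> over p = o ->
  find (fun q => (name q == name p) && (over q == o)) w = index p w.
Proof.
move=> pw po; apply: eq_in_find => q qw /=.
apply/andP/eqP => [[/eqP e /eqP qo]|->]; last by rewrite po !eqxx.
case: (gauss_name pw qw e) => // qp.
by move: qo; rewrite qp -po; case: (p) => [[n []] s].
Qed.

Lemma over_posE p : p \in w ->
  over_pos w (name p) = index (if over p then p else other p) w.
Proof.
move=> pw; rewrite /over_pos.
rewrite (@eq_find _ _ (fun q => (name q == name p) && (over q == true))); last first.
  by move=> q; rewrite eqb_id.
case: ifP => po; first exact: find_passage.
rewrite -[name p]/(name (other p)) find_passage ?gauss_other //.
by move: po; case: (p) => [[n []] s].
Qed.

Lemma under_posE p : p \in w ->
  under_pos w (name p) = index (if over p then other p else p) w.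
Proof.
move=> pw; rewrite /under_pos.
rewrite (@eq_find _ _ (fun q => (name q == name p) && (over q == false))); last first.
  by move=> q; rewrite eqbF_neg.
case: ifP => po; last exact: find_passage.
rewrite -[name p]/(name (other p)) find_passage ?gauss_other //.
by move: po; case: (p) => [[n []] s].
Qed.

Lemma signE p : p \in w -> sign w (name p) = positive p.
Proof.
move=> pw; apply/hasP/idP => [[q qw /andP [/eqP e qs]]|ps]; last first.
  by exists p => //; rewrite eqxx.
by case: (gauss_name pw qw e) qs => ->.
Qed.

End GaussCode.

Definition corner_signs : seq (bool * bool) :=
  [:: (true, true); (true, false); (false, true); (false, false)].

Section Colouring.
Variable T : eqType.
Implicit Types (w : code) (h : nat * bool -> T) (p : passage) (D : seq passage).

(** Here [m.1] and [m.2] tell whether the corner is next to the outgoing half-edge of the strand of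
    [p] and of that of [other p]; the colour is read on the edge of [p]. *)
Definition vertex w h p : seq ({fraction {poly int}} * T) :=
  [seq (corner_label W (positive p) m.1 m.2, h (index p w + m.1, m.2 == eps p)%N)
  | m <- corner_signs].

Lemma vertexE w h p : vertex w h p =
  let c a b := (corner_label W (positive p) a b, h (index p w + a, b == eps p)%N) in
  [:: c true true; c true false; c false true; c false false].
Proof. by []. Qed.

Definition corner_colour w h p := forall a b : bool,
  h (index p w + a, b == eps p)%N = h (index (other p) w + b, a == ~~ eps p)%N.

Definition colouring w h :=
  [/\ h (0, true)%N = h (0, false)%N, h (size w, true) = h (size w, false)
    & {in w, forall p, corner_colour w h p}].

Lemma corner_colour_other w h p :
  corner_colour w h p -> corner_colour w h (other p).
Proof. by move=> hp a b; rewrite otherK eps_other negbK -hp. Qed.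

(** Exchanging the strands transposes the corners, and the two side corners have equal labels; so
    either passage may represent a crossing. *)
Lemma vertex_other w h p : corner_colour w h p ->
  perm_eq (vertex w h (other p)) (vertex w h p).
Proof.
move=> hp; rewrite !vertexE; cbv beta zeta; rewrite !(corner_colour_other hp).
rewrite otherK eps_other negbK.
have -> : positive (other p) = positive p by [].
have -> s : corner_label W s false true = corner_label W s true false by case: s.
have pe (x1 x2 x3 x4 : {fraction {poly int}} * T) :
  perm_eq [:: x1; x3; x2; x4] [:: x1; x2; x3; x4].
  by rewrite perm_cons perm_cons2.
exact: pe.
Qed.

(** One passage per crossing, freely chosen, so that the list can start with the crossings of a
    move. *)
Definition crossing_list w D := perm_eq (D ++ map other D) w.

(** Since [h] is defined at all numbers, only its values on actual edges may be counted. *)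
Definition attains w h (vals : seq T) := {in vals, forall v,
  exists x : nat * bool, (x.1 <= size w)%N /\ h x = v}.

End Colouring.


Lemma adjacent_sym w : symmetric (@adjacent w).
Proof.
move=> x y; rewrite /adjacent; congr (_ || _).
  by apply/existsP/existsP => -[k hk]; exists k; rewrite orbC.
by rewrite (eq_sym y.1); case: eqP => [->|].
Qed.

Lemma region_ofP w (x y : side w) :
  reflect (region_of x = region_of y) (connect (@adjacent w) x y).
Proof.
have sc := sym_connect_sym (@adjacent_sym w).
apply: (iffP idP) => [xy|/setP /(_ y)]; last by rewrite !inE connect0.
by apply/setP => z; rewrite !inE (same_connect sc xy).
Qed.

Lemma region_of_regions w (x : side w) : region_of x \in regions w.
Proof. exact: imset_f. Qed.

(** The universal colouring: each side is coloured by its own region. *)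
Definition rho w (x : nat * bool) : {set side w} := region_of (mk_side w x.1 x.2).

(** * State sums computed from a colouring *)

Section Nabla.
Variable w : code.
Hypothesis gw : gauss_code w.

Lemma val_mk_side e s : (e <= size w)%N -> val (mk_side w e s).1 = e.
Proof. by move=> ew; rewrite /= inordK. Qed.

Lemma index_bound p (a : bool) : p \in w -> (index p w + a <= size w)%N.
Proof.
by rewrite -index_mem; case: a; rewrite ?addn1 ?addn0 // => /ltnW.
Qed.

Lemma corner_sides p (pw : name p \in [seq name q | q <- w]) (a b : bool) :
  p \in w ->
  let c : crossing w := SeqSub pw in
  let k := (c, if over p then (a, b) else (b, a)) in
  let x := mk_side w (index p w + a) (b == eps p) in
  let y := mk_side w (index (other p) w + b) (a == ~~ eps p) in
  (over_side k, under_side k) = if over p then (x, y) else (y, x).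
Proof.
move=> pin /=; rewrite /eps; case: ifP => po /=.
  rewrite over_posE // under_posE // signE // po; congr (_, mk_side _ _ _).
  by case: (a); case: (positive p).
rewrite over_posE // under_posE // signE // po.
by congr (mk_side _ _ _, mk_side _ _ _); case: (a); case: (b); case: (positive p).
Qed.

Lemma colouring_rho : colouring w (rho w).
Proof.
split.
- apply/region_ofP/connect1; rewrite /adjacent /= eqxx inordK //=.
  by rewrite ?eqxx ?orbT.
- apply/region_ofP/connect1; rewrite /adjacent /= eqxx inordK //=.
  by rewrite ?eqxx ?orbT.
move=> p pw a b; apply/region_ofP/connect1; apply/or3P; apply: Or31.
apply/existsP; have pn := map_f name pw.
exists (SeqSub pn, if over p then (a, b) else (b, a)).
by rewrite corner_sides //; case: ifP => _; rewrite eqxx ?orbT.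
Qed.

Section Count.
Variable D : seq passage.
Hypothesis Dw : crossing_list w D.

Lemma crossing_list_mem p : p \in w -> p \in D \/ other p \in D.
Proof.
rewrite -(perm_mem Dw) mem_cat => /orP [|/mapP [q qD ->]]; first by left.
by rewrite otherK; right.
Qed.

Lemma crossing_list_sub p : p \in D -> p \in w.
Proof. by move=> pD; rewrite -(perm_mem Dw) mem_cat pD. Qed.

Lemma perm_crossings :
  perm_eq [seq val c | c <- enum (crossing w)] [seq name p | p <- D].
Proof.
have uD : uniq (D ++ map other D) by rewrite (perm_uniq Dw) gauss_uniq.
apply: uniq_perm.
- by rewrite map_inj_uniq ?enum_uniq //; apply: val_inj.
- rewrite map_inj_in_uniq; first by move: uD; rewrite cat_uniq => /and3P [].
  move=> p q pD qD /esym e.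
  have [//|qp] := gauss_name gw (crossing_list_sub pD) (crossing_list_sub qD) e.
  move: uD; rewrite cat_uniq => /and3P [_ /hasPn /(_ q) h _].
  by move: h; rewrite {1}qp map_f // qD => /(_ isT).
move=> c; apply/mapP/mapP => [[c' _ ->]|[p pD ->]].
  have /mapP [p pw e] := ssvalP c'.
  by case: (crossing_list_mem pw) => ?; [exists p | exists (other p)].
have pn := map_f name (crossing_list_sub pD).
by exists (SeqSub pn : crossing w); rewrite ?mem_enum.
Qed.

Lemma card_crossing : #|crossing w| = size D.
Proof. by rewrite cardE; have /perm_size := perm_crossings; rewrite !size_map. Qed.

Lemma size_crossing_list : size w = (size D + size D)%N.
Proof. by rewrite -(perm_size Dw) size_cat size_map. Qed.

Hypothesis sw : spherical w.

Lemma card_regions : #|regions w| = (size D).+1.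
Proof.
move: sw; rewrite /spherical card_crossing card_ord size_crossing_list => /eqP.
lia.
Qed.

Section Colour.
Variables (T : eqType) (h : nat * bool -> T).
Hypothesis hw : colouring w h.

Definition side_colour (x : side w) : T := h (val x.1, x.2).

Lemma side_colour_mk e s : (e <= size w)%N -> side_colour (mk_side w e s) = h (e, s).
Proof. by move=> ew; rewrite /side_colour val_mk_side. Qed.

Lemma side_colour_corner (k : corner w) :
  side_colour (over_side k) = side_colour (under_side k).
Proof.
case: hw => _ _ hc; case: k => [[c cw] [a b]].
have /mapP [p0 p0w ce] := cw.
have [p [pw pn po]] : exists p, [/\ p \in w, name p = c & over p].
  case: (boolP (over p0)) => po; first by exists p0.
  exists (other p0); split; rewrite ?gauss_other //.
move: cw; rewrite -pn => cw.
have := corner_sides cw a b pw; rewrite po => e.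
have /= -> := congr1 fst e; have /= -> := congr1 snd e.
rewrite !side_colour_mk ?index_bound ?gauss_other //.
exact: hc.
Qed.

Lemma side_colour_adjacent x y : adjacent x y -> side_colour x = side_colour y.
Proof.
case: (hw) => h0 hn _; case/or3P.
- case/existsP => k /orP [] /eqP [-> ->]; first exact: side_colour_corner.
  by rewrite side_colour_corner.
- case: x y => [i s] [j t] /= /andP [/eqP <- /eqP i0]; rewrite /side_colour /=.
  by rewrite [nat_of_ord i]i0; case: s; case: t.
- case: x y => [i s] [j t] /= /andP [/eqP <- /eqP i0]; rewrite /side_colour /=.
  by rewrite [nat_of_ord i]i0; case: s; case: t.
Qed.

Lemma side_colour_region x y : region_of x = region_of y ->
  side_colour x = side_colour y.
Proof.
move=> /region_ofP /connectP [p]; elim: p x => [x _ -> //|z p IH x] /=.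
by move=> /andP [/side_colour_adjacent -> zp yp]; apply: IH.
Qed.

Definition region_colour (r : {set side w}) : T :=
  side_colour (odflt (ord0, true) [pick x in r]).

Lemma region_colourE x : region_colour (region_of x) = side_colour x.
Proof.
rewrite /region_colour; case: pickP => [y|/(_ x)]; last by rewrite inE connect0.
by rewrite inE => /region_ofP e; apply/esym/side_colour_region.
Qed.

Variable vals : seq T.
Hypotheses (uv : uniq vals) (av : attains w h vals).

Lemma attains_regions : {subset vals <= map region_colour (enum (regions w))}.
Proof.
move=> v /av [[e s] [/= ew <-]]; rewrite -side_colour_mk // -region_colourE.
by apply: map_f; rewrite mem_enum region_of_regions.
Qed.

Lemma size_colours : (size vals <= (size D).+1)%N.
Proof.
have := uniq_leq_size uv attains_regions.
by rewrite size_map -cardE card_regions.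
Qed.

Hypothesis full : (size D < size vals)%N.

Lemma side_colour_inj x y : side_colour x = side_colour y ->
  region_of x = region_of y.
Proof.
rewrite -!region_colourE.
have /dinjectiveP inj : dinjectiveb region_colour (mem (regions w)).
  apply: (leq_size_uniq uv attains_regions).
  by rewrite size_map -cardE card_regions.
by apply: inj; rewrite region_of_regions.
Qed.

(** The [size D] markers lie in distinct unstarred regions, of which there are exactly [size D]; so
    each of these receives one. *)
Lemma is_stateE S : is_state S =
  marking (fun k => side_colour (over_side k)) (enum (crossing w))
    [:: h (0, true)%N] S.
Proof.
have starE x : (region_of x == starred w) = (side_colour x == h (0, true)%N).
  rewrite -side_colour_mk // /starred.
  by apply/eqP/eqP => [/side_colour_region|/side_colour_inj].
apply/andP/markingP => [[/forallP h1 /forall_inP h2]|[h1 h2 h3]]; split.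
- by move=> c; rewrite mem_enum; apply/eqP.
- move=> k kS; rewrite inE -starE; apply/negP => ks.
  have := h2 _ (region_of_regions (over_side k)).
  rewrite ks cards_eq0 => /eqP /setP /(_ k).
  by rewrite !inE kS eqxx.
- move=> k l kS lS /side_colour_inj kl.
  have := h2 _ (region_of_regions (over_side k)).
  case: ifP => [_|_ /cards1P [m /setP mP]].
    by rewrite cards_eq0 => /eqP /setP /(_ k); rewrite !inE kS eqxx.
  have := mP k; have := mP l; rewrite !inE kS lS /region_at kl eqxx.
  by move=> /esym /eqP -> /esym /eqP ->.
- by apply/forallP => c; rewrite h1 mem_enum.
have inj : {in S &, injective (@region_at w)}.
  by move=> k l kS lS /side_colour_region; apply: h3.
have cS : #|S| = size D.
  rewrite -card_crossing -sum1_card (partition_big (fun k => k.1) predT) //=.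
  rewrite -sum1_card; apply: eq_bigr => c _.
  transitivity #|[set k in S | k.1 == c]|; last by rewrite h1 mem_enum.
  by rewrite -sum1_card; apply: eq_bigl => k; rewrite inE.
have sub : (@region_at w) @: S \subset regions w :\ starred w.
  apply/subsetP => r /imsetP [k kS ->]; rewrite in_setD1 region_of_regions andbT.
  by rewrite starE; have := h2 k kS; rewrite inE.
have eqS : (@region_at w) @: S = regions w :\ starred w.
  apply/eqP; rewrite eqEcard sub card_in_imset // cS.
  have := cardsD1 (starred w) (regions w); rewrite region_of_regions card_regions.
  by rewrite /= add1n => -[<-].
apply/forall_inP => r rr; have [->|rs] := eqVneq r (starred w).
  rewrite cards_eq0; apply/eqP/setP => k; rewrite !inE starE.
  by apply/negP => /andP [/h2]; rewrite inE => /negPf ->.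
have : r \in regions w :\ starred w by rewrite in_setD1 rs.
rewrite -eqS => /imsetP [k kS ->]; apply/cards1P; exists k.
apply/setP => l; rewrite !inE; apply/andP/eqP => [[lS /eqP /inj -> //]|->].
by rewrite kS.
Qed.

(** The colours need not be regions of [w]: colours borrowed from the other diagram of a move make
    the two state sums directly comparable. *)
Lemma nabla_colouring :
  nabla w = statesum (map (vertex w h) D) [:: h (0, true)%N].
Proof.
pose V c := [seq (corner_label W (sign w c) m.1 m.2,
                  h (over_pos w c + m.1, m.2 == sign w c)%N)
            | m <- enum ((bool * bool)%type : finType)].
transitivity (statesum [seq V c | c <- [seq val c | c <- enum (crossing w)]]
               [:: h (0, true)%N]).
  rewrite /nabla (eq_bigl _ _ is_stateE) sum_markings ?enum_uniq //.
  rewrite -[X in _ = statesum X _]map_comp; congr statesum; apply: eq_map => -[c cw] /=.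
  apply: eq_map => -[a b] /=; congr (_, _).
  rewrite side_colour_mk //.
  have /mapP [p pw ce] := cw; rewrite ce over_posE // index_bound //.
  by case: ifP => _; rewrite ?gauss_other.
rewrite (statesum_perm _ (perm_map V perm_crossings)) -map_comp.
apply: statesum_map_perm => p /crossing_list_sub pw; rewrite /= /V.
have -> : enum ((bool * bool)%type : finType) = corner_signs.
  by rewrite enumT unlock /= /prod_enum enumT unlock.
case: (hw) => _ _ /(_ p pw) hp; rewrite over_posE // signE //.
(* The corners of [nabla] are described from the over strand; when [p] goes under, its vertex is
   exchanged for that of [other p]. *)
case: ifP => po; first by rewrite /vertex /eps po.
have e : eps (other p) = positive p.
  by rewrite eps_other /eps po; case: (positive p).
by apply: perm_trans (vertex_other hp); rewrite /vertex e.

Qed.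

End Colour.
End Count.
End Nabla.

(** * Renaming and the first move *)

Lemma W_neq0 : W != 0.
Proof. by rewrite tofrac_eq0 polyX_eq0. Qed.

(** Closure under [other] is assumed instead of [gauss_code], so as to cover also the passages
    outside a triangle. *)
Lemma crossing_list_over (w : seq passage) : uniq w ->
  (forall p, (other p \in w) = (p \in w)) ->
  crossing_list w [seq p <- w | over p].
Proof.
move=> uw ow.
apply: (@perm_trans _ ([seq p <- w | over p] ++ [seq p <- w | ~~ over p]));
  last exact/permPl/perm_filterC.
rewrite perm_cat2l; apply: uniq_perm.
- by rewrite map_inj_uniq ?filter_uniq //; apply: inv_inj otherK.
- exact: filter_uniq.
move=> p; apply/mapP/idP => [[q]|].
  by rewrite !mem_filter => /andP [qo qw ->]; rewrite ow qw; case: (q) qo => [[n []]].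
rewrite mem_filter => /andP [po pw]; exists (other p); last by rewrite otherK.
by rewrite mem_filter ow pw; case: (p) po => [[n []]].
Qed.

Lemma crossing_list_gauss w : gauss_code w -> crossing_list w [seq p <- w | over p].
Proof.
by move=> gw; apply: crossing_list_over (gauss_uniq gw) (gauss_other gw).
Qed.

Lemma crossing_list_cons p s D :
  crossing_list s D -> crossing_list [:: p, other p & s] (p :: D).
Proof.
rewrite /crossing_list /= perm_cons => Ds.
by rewrite (perm_catCA D [:: other p]) /= perm_cons.
Qed.

Lemma attains_rho w : attains w (rho w) (enum (regions w)).
Proof.
move=> r; rewrite mem_enum => /imsetP [[i s] _ ->].
exists (val i, s); split; first by rewrite /= -ltnS.
by rewrite /rho /mk_side /= inord_val.
Qed.

Lemma nabla_rho w D : gauss_code w -> spherical w -> crossing_list w D ->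
  nabla w = statesum (map (vertex w (rho w)) D) [:: rho w (0, true)%N].
Proof.
move=> gw sw Dw; apply: (nabla_colouring gw Dw sw (colouring_rho gw)
  (enum_uniq _) (@attains_rho w)).
by rewrite -cardE (card_regions gw Dw sw).
Qed.

(** Renaming leaves positions, hence edges and sides, unchanged, so [rho w] is itself a colouring of
    [w']. *)
Lemma mock_isotopic (K K' : knotoid_diagram) :
  isotopic K K' -> mock_alexander K = mock_alexander K'.
Proof.
case: K K' => w gw sw [w' gw' sw'] /= [f finj ew'].
rewrite /mock_alexander /=.
pose g p : passage := (f (name p), over p, positive p).
have ginj : injective g.
  move=> [[n o] s] [[n' o'] s'] [/finj].
  by rewrite /name /over /positive /= => -> -> ->.
have wE : w' = map g w by [].
have Dw := crossing_list_gauss gw; set D := filter _ _ in Dw.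
have Dw' : crossing_list w' (map g D).
  by rewrite /crossing_list wE; have := perm_map g Dw; rewrite map_cat -!map_comp.
have ind p : index (g p) w' = index p w by rewrite wE index_map.
have [h0 hn hc] := colouring_rho gw.
have col : colouring w' (rho w).
  split=> //; first by rewrite wE size_map.
  move=> p'; rewrite wE => /mapP [p pw ->] a b.
  by rewrite -wE ind -[other (g p)]/(g (other p)) ind; apply: hc.
have att : attains w' (rho w) (enum (regions w)).
  by move=> r /(@attains_rho w) [x hx]; exists x; rewrite wE size_map.
rewrite (nabla_rho gw sw Dw) (nabla_colouring gw' Dw' sw' col (enum_uniq _) att).
  by rewrite -map_comp; congr statesum; apply: eq_map => p; rewrite /= /vertex ind.
by rewrite -cardE (card_regions gw Dw sw) size_map.
Qed.

(* [skip] and [skip_edge] renumber positions and edges when two passages are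
   inserted at position [a]. *)
Definition skip a i := if (i < a)%N then i else i.+2.

Lemma index_insert (p x y : passage) u v : p \notin [:: x; y] ->
  index p (u ++ [:: x; y] ++ v) = skip (size u) (index p (u ++ v)).
Proof.
rewrite !inE negb_or => /andP [px py]; rewrite /skip !index_cat.
case: ifP => pu; first by rewrite index_mem pu.
rewrite ltnNge leq_addr /= !inE (negPf px) (negPf py) /=.
by rewrite !add2n !addnS.
Qed.

Lemma insert_uniq (q x y : passage) u v : uniq (u ++ [:: x; y] ++ v) ->
  q \in u ++ v -> q \notin [:: x; y].
Proof.
rewrite (perm_uniq (permEl (perm_catCA u [:: x; y] v))) cat_uniq.
by move=> /and3P [_ /hasPn h _] /h.
Qed.

Section Kink.
Variables (T : eqType) (u v : code) (p : passage) (h : nat * bool -> T).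
Let a := size u.

(* The colouring of a diagram with a kink at [p] induced by a colouring of the
   diagram without it; the monogon gets the new colour [None]. *)
Definition kink (x : nat * bool) : option T :=
  if x.1 == a.+1 then if x.2 == eps p then Some (h (a, ~~ eps p)) else None
  else Some (h (if (x.1 <= a)%N then x.1 else x.1.-2, x.2)).

Lemma kink_skip i (b : bool) s : kink (skip a i + b, s)%N = Some (h (i + b, s)%N).
Proof.
rewrite /kink /skip /=; case: ltnP => ia.
  by case: b; rewrite ?addn1 ?addn0; case: eqP => ?; try lia; case: leqP => ?; try lia.
case: b; rewrite ?addn1 ?addn0; case: eqP => ?; try lia; case: leqP => ?; try lia; done.
Qed.

Let w := u ++ [:: p; other p] ++ v.
Hypothesis gw : gauss_code w.

Lemma kink_index : index p w = a /\ index (other p) w = a.+1.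
Proof.
have := gauss_uniq gw; rewrite /w cat_uniq => /and3P [_ /hasPn h' /andP [hp _]].
have pu := h' p; have qu := h' (other p).
split; rewrite index_cat.
  rewrite (negPf (pu _)) ?mem_head //= eqxx addn0 //.
rewrite (negPf (qu _)) ?inE ?eqxx ?orbT //=.
move: hp; rewrite inE negb_or => /andP [/negPf -> _].
by rewrite eqxx addn1.
Qed.

Lemma colouring_kink : colouring (u ++ v) h -> colouring w kink.
Proof.
have [ip iq] := kink_index; case=> h0 hn hc.
have i0 s : kink (0, s)%N = Some (h (0, s)%N) by [].
have kn s : kink (size w, s) = Some (h (size (u ++ v), s)).
  have := kink_skip (size (u ++ v)) false s; rewrite !addn0 => <-; congr kink.
  by rewrite /skip /w !size_cat /a; case: ltnP => ?; congr (_, _); rewrite /=; lia.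
(* At the kink, the inner side of the loop meets only itself, and its outer side continues the side
   [~~ eps p] of the edges [a] and [a.+2]. *)
have cp : corner_colour w kink p.
  have e1 : (a == a.+1) = false by apply/eqP; lia.
  have e2 : (a.+2 == a.+1) = false by apply/eqP; lia.
  have e3 : (a.+1 < a)%N = false by apply/negP; lia.
  move=> b c; rewrite ip iq; case: b; case: c; rewrite /kink ?addn0 ?addn1 /=;
  by case: (eps p); rewrite ?eqxx ?e1 ?e2 ?e3 ?leqnn.
split=> [|| q]; rewrite ?i0 ?kn ?h0 ?hn // /w mem_cat mem_cat orbCA -mem_cat.
case: (boolP (q \in [:: p; other p])) => [+ _|qp /= quv b c].
  by rewrite !inE => /orP [] /eqP -> //; apply: corner_colour_other.
have qp' : other q \notin [:: p; other p].
  apply: contra qp; rewrite !inE => /orP [] /eqP; last first.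
    by move=> /(can_inj otherK) ->; rewrite eqxx.
  by move=> <-; rewrite otherK eqxx orbT.
by rewrite /w !index_insert // !kink_skip; congr Some; apply: hc.
Qed.

End Kink.

Lemma mock_RI (K K' : knotoid_diagram) :
  RI K K' -> mock_alexander K = mock_alexander K'.
Proof.
case: K K' => w gw sw [w' gw' sw'] /= [u [v [p [ew ew']]]].
rewrite /mock_alexander /=; subst w w'.
set w := u ++ _ in gw sw *; set w' := u ++ v in gw' sw' *.
have [ip iq] := kink_index gw.
have Dw' := crossing_list_gauss gw'; set D := filter _ _ in Dw'.
have Dw : crossing_list w (p :: D).
  by rewrite /crossing_list perm_sym perm_catCA perm_sym; apply: crossing_list_cons.
pose h x := Some (rho w' x).
have [h0 hn hc] := colouring_rho gw'.
have col' : colouring w' h.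
  by split=> [||q qw b c]; rewrite /h ?h0 ?hn // hc.
have col := colouring_kink gw (colouring_rho gw').
set k := kink _ _ _ in col.
have ks i (b : bool) s : k (skip (size u) i + b, s)%N = h (i + b, s)%N.
  by rewrite /k kink_skip.
pose rs := map (@Some _) (enum (regions w')).
have urs : uniq rs by rewrite map_inj_uniq ?enum_uniq // => x y [].
have att' : attains w' h rs.
  by move=> _ /mapP [r /(@attains_rho w') [x [xw <-]] ->]; exists x.
have hrs x : h x \in rs by apply: map_f; rewrite mem_enum region_of_regions.
(* The additional colour [None] compensates for the additional crossing in the count. *)
have att : attains w k (None :: rs).
  move=> r; rewrite inE => /predU1P [->|/att' [[e s] [xw <-]]].
    exists ((size u).+1, ~~ eps p); split.
      by rewrite /= /w size_cat /=; lia.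
    by rewrite /k /kink /= eqxx; case: (eps p).
  exists (skip (size u) e, s); split.
    by move: xw; rewrite /skip /w /w' !size_cat /=; case: ltnP => ? ?; lia.
  by have := ks e false s; rewrite !addn0.
have size_rs : size rs = (size D).+1.
  by rewrite size_map -cardE (card_regions gw' Dw' sw').
have mem w0 q : all (fun m => m.2 \in rs) (vertex w0 h q).
  by apply/allP => m /mapP [n _ ->]; apply: hrs.
rewrite (nabla_colouring gw' Dw' sw' col' urs att') ?size_rs //.
rewrite (nabla_colouring gw Dw sw col _ att) /= ?urs ?size_rs ?andbT //; last first.
  by apply/mapP => -[].
rewrite [map (vertex w k) D](_ : _ = map (vertex w' h) D); last first.
  apply/eq_in_map => q; rewrite mem_filter => /andP [_ qw'].
  apply: eq_map => m; rewrite /w index_insert ?ks //.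
  exact: insert_uniq (gauss_uniq gw) qw'.
(* The monogon is at the corner between the half-edge leaving along [p] and the one arriving at
   [other p], which is a side corner. *)
have vp : perm_eq (vertex w k p) ((1, None) ::
  [:: (corner_label W (positive p) true true, k (size u + true, true == eps p)%N);
    (corner_label W (positive p) false true, k (size u + false, true == eps p)%N);
    (corner_label W (positive p) false false, k (size u + false, false == eps p)%N)]).
  rewrite vertexE ip; cbv beta zeta.
  have -> : k (size u + true, false == eps p)%N = None.
    by rewrite /k /kink addn1 eqxx; case: (eps p).
  have -> : corner_label W (positive p) true false = 1 by case: (positive p).
  exact: perm_cons2.
rewrite -/(statesum (vertex w k p :: map (vertex w' h) D) _).
rewrite (statesum_cons_perm _ _ vp).
apply: (statesum_monogon (rs := rs)) => //; rewrite ?size_rs ?size_map //.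
- by apply/allP => _ /mapP [q _ ->].
- by apply/mapP => -[].
- exact: (hrs (0, true)%N).
have k0 s : k (size u + false, s)%N \in rs.
  rewrite addn0 /k /kink /= leqnn; case: eqP => [|_]; first lia.
  exact: hrs.
rewrite /= !k0 !andbT /k /kink /= addn1 eqxx.
by case: (eps p); apply: hrs.
Qed.

(** * The second move *)

Lemma index_strand (x y : passage) u v (b : bool) : uniq (u ++ [:: x; y] ++ v) ->
  index (if b then y else x) (u ++ [:: x; y] ++ v) = (size u + b)%N.
Proof.
rewrite cat_uniq => /and3P [_ /hasPn h' /andP [hp _]].
have xu : x \notin u by apply: h'; rewrite mem_head.
have yu : y \notin u by apply: h'; rewrite !inE eqxx orbT.
case: b; rewrite index_cat; last by rewrite (negPf xu) /= eqxx.
rewrite (negPf yu) /=.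
by move: hp; rewrite inE negb_or => /andP [/negPf -> _]; rewrite eqxx addn1.
Qed.

Lemma index_mem_inj (p q : passage) w : p \in w ->
  index p w = index q w -> p = q.
Proof.
move=> pw e; rewrite -(nth_index p pw) e nth_index //.
by rewrite -index_mem -e index_mem.
Qed.

Lemma positive_eps p : positive p = (over p == eps p).
Proof. by rewrite /eps; case: (over p); case: (positive p). Qed.

Lemma vertex_perm (T : eqType) w (h : nat * bool -> T) p x z :
  perm_eq (vertex w h p)
    [seq (corner_label W (positive p) m.1 m.2, h (index p w + m.1, m.2 == eps p)%N)
    | m <- [:: (~~ x, z); (~~ x, ~~ z); (x, z); (x, ~~ z)]].
Proof. by apply: perm_map; case: x; case: z. Qed.

Lemma mk_side_inj w (x y : nat * bool) : (x.1 <= size w)%N -> (y.1 <= size w)%N ->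
  mk_side w x.1 x.2 = mk_side w y.1 y.2 -> x = y.
Proof.
case: x y => [e s] [f t] /= ew fw [/(congr1 val)].
by rewrite /= !inordK // => -> ->.
Qed.

Lemma rho_face w (M : seq (nat * bool)) (x : side w) (m : nat * bool) :
  all (fun m => m.1 <= size w)%N M ->
  region_of x = [set z in [seq mk_side w m.1 m.2 | m <- M]] ->
  (m.1 <= size w)%N -> (rho w m == region_of x) = (m \in M).
Proof.
move=> /allP Mw xM mw; apply/eqP/idP => [e|mM].
  have : mk_side w m.1 m.2 \in rho w m by rewrite inE connect0.
  rewrite e xM inE => /mapP [m' m'M] /(@mk_side_inj _ m m') -> //.
  exact: Mw.
apply/esym/region_ofP.
have : mk_side w m.1 m.2 \in region_of x by rewrite xM inE; apply: map_f.
by rewrite inE.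
Qed.

Definition skip_edge a e := if (e <= a)%N then e else e.+2.

Lemma skip_edgeE (T : Type) (f : nat * bool -> T) a i (b : bool) s :
  (forall s, f (a, s) = f (a.+2, s)) ->
  f (skip_edge a (i + b), s)%N = f (skip a i + b, s)%N.
Proof.
move=> fa; rewrite /skip_edge /skip; case: (ltngtP i a) => ia.
- by rewrite ifT //; case: b; lia.
- by rewrite ifF ?addSn //; case: b; lia.
- rewrite ia; case: b; rewrite ?addn1 ?addn0; last by rewrite leqnn.
  by rewrite ltnn.
Qed.

Lemma skip_neq a n (b : bool) : (skip a n + b)%N != a.+1.
Proof. by rewrite /skip; case: ltnP => ?; case: b; apply/eqP; lia. Qed.

Lemma skip_skip_neq a c n (b : bool) : (a <= c)%N ->
  (skip a (skip c n) + b)%N != c.+3.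
Proof.
by move=> ac; rewrite /skip; case: (ltnP n c) => ?; case: ltnP => ?; case: b;
  apply/eqP; lia.
Qed.

Lemma perm_strands (T : eqType) (w0 w1 w2 : seq T) (a b c d : T) :
  perm_eq [:: a, b, c, d & w0 ++ w1 ++ w2] (w0 ++ [:: a; b] ++ w1 ++ [:: c; d] ++ w2).
Proof. by apply/permP => p; rewrite /= !count_cat /= !count_cat /=; lia. Qed.

(** The sign [o == (b == t)] of crossing [b] changes with [b], as both passages of a strand are over
    or both under. The strands run in opposite directions when [s == t], and [z b] is the passage of
    the second strand at crossing [b]. *)
Lemma bigon_labels (F : fieldType) (x : F) (o s t : bool) : x != 0 ->
  let l b := corner_label x (o == (b == t)) in
  let z b := b (+) (s == t) in
  [/\ l false (~~ false) (~~ z false) * l true true (z true) = 1,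
      l true (~~ true) (~~ z true) * l false false (z false) = 1,
      l false (~~ false) (~~ z false) * l true (~~ true) (z true) +
      l true (~~ true) (~~ z true) * l false (~~ false) (z false) = 0
    & l false (~~ false) (~~ z false) * l true true (~~ z true) +
      l true (~~ true) (~~ z true) * l false false (~~ z false) = 0].
Proof.
by move=> x0; case: o; case: s; case: t; rewrite /corner_label /=; split; field.
Qed.

Section Bigon.
Variables (w0 w1 w2 : code) (p1 p2 q1 q2 : passage) (s t : bool).
Let w := w0 ++ [:: p1; p2] ++ w1 ++ [:: q1; q2] ++ w2.
Let w' := w0 ++ w1 ++ w2.
Let i := size w0.
Let j := (size w0 + size w1).+2.
Hypotheses (gw : gauss_code w) (sw : spherical w).
Hypotheses (gw' : gauss_code w') (sw' : spherical w').
Hypothesis over12 : over p1 = over p2.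
Let x := mk_side w i.+1 s.
Let y := mk_side w j.+1 t.
Hypothesis xy : region_of x = [set x; y].

Let P (b : bool) := if b then p2 else p1.
Let Q (b : bool) := if b then q2 else q1.
Let d := region_of x.

Let size_w : size w = (size w').+4.
Proof. by rewrite /w /w' !size_cat /= !addnS. Qed.

Let ijw : (i <= size w /\ i.+2 <= j /\ j.+2 <= size w)%N.
Proof. by rewrite /w /i /j !size_cat /=; lia. Qed.

Let i1w : (i.+1 <= size w)%N.
Proof. by have [_ [a b]] := ijw; exact: ltnW (leq_trans a (ltnW (ltnW b))). Qed.

Let wQ : w = (w0 ++ [:: p1; p2] ++ w1) ++ [:: q1; q2] ++ w2.
Proof. by rewrite /w -!catA. Qed.

Let indexP b : index (P b) w = (i + b)%N.
Proof. exact/index_strand/gauss_uniq. Qed.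

Let indexQ b : index (Q b) w = (j + b)%N.
Proof.
have -> : j = size (w0 ++ [:: p1; p2] ++ w1) by rewrite !size_cat /= /j !addnS.
rewrite wQ; apply: index_strand; rewrite -wQ; exact: gauss_uniq.
Qed.

Let memP b : P b \in w.
Proof. by rewrite /w !mem_cat !inE /P; case: b; rewrite eqxx ?orbT. Qed.

Let faceE m : (m.1 <= size w)%N -> ((rho w) m == d) = (m \in [:: (i.+1, s); (j.+1, t)]).
Proof.
apply: rho_face; first by rewrite /=; have := ijw; lia.
by rewrite -/(mk_side w _ _) xy; apply/setP => z; rewrite !inE.
Qed.

(** Turning around the corner of the bigon at [P b] leads again to [x] or [y]. The side [x] would
    pair two passages of the first strand, against [over12]; so it is [y], which determines both the
    partner and [eps]. *)
Let strand_mid b : eps (P b) = (b == t) /\ other (P b) = Q (b (+) (s == t)).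
Proof.
have [_ _ hc] := colouring_rho gw.
have := hc _ (memP b) (~~ b) (s == eps (P b)); rewrite indexP.
have -> : ((s == eps (P b)) == eps (P b)) = s by case: (s); case: eps.
have -> : (i + b + ~~ b = i.+1)%N by case: b; rewrite /= !(addn0, addn1).
have -> : (~~ b == ~~ eps (P b)) = (b == eps (P b)) by case: b; case: eps.
have/eqP -> : (rho w) (i.+1, s) == d by rewrite faceE ?mem_head //; apply: i1w.
move/esym/eqP; rewrite faceE; last by apply: index_bound; rewrite gauss_other.
have sub1 k (c : bool) n : (k + c)%N = n.+1 -> k = (n + ~~ c)%N.
  by case: c; rewrite /= ?addn1 ?addn0 // => -[].
have pw' : other (P b) \in w by rewrite gauss_other.
rewrite !inE !xpair_eqE => /orP [/andP [/eqP /sub1 e _]|/andP [/eqP /sub1 e /eqP bt]].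
  have := index_mem_inj pw' (etrans e (esym (indexP _))).
  have oP c : over (P c) = over p1 by rewrite /P; case: c.
  move/(congr1 over); rewrite oP -(oP b).
  by case: (P b) => [[n []]].
have eb : eps (P b) = (b == t) by rewrite -bt; case: b {bt e pw'} => //; case: eps.
have -> : b (+) (s == t) = ~~ (s == eps (P b)).
  by rewrite eb; case: b {bt e pw' eb}; case: (s); case: (t).
split=> //; exact: index_mem_inj pw' (etrans e (esym (indexQ _))).
Qed.

Let epsP b : eps (P b) = (b == t). Proof. by case: (strand_mid b). Qed.
Let otherP b : other (P b) = Q (b (+) (s == t)).
Proof. by case: (strand_mid b). Qed.

(* A corner at [P b] lies away from the bigon along the strand [P] if [a], and
   along the strand [Q] if [c]. *)
Let cornerP (b a c : bool) :
  rho w (i + b + (if a then b else ~~ b), c (+) s)%N =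
  rho w (j + (b (+) (s == t)) + (c (+) ~~ (b (+) (s == t))), a (+) t)%N.
Proof.
have [_ _ hc] := colouring_rho gw.
have := hc _ (memP b) (if a then b else ~~ b) (c (+) ~~ (b (+) (s == t))).
rewrite indexP otherP indexQ epsP.
have -> : (c (+) ~~ (b (+) (s == t)) == (b == t)) = c (+) s.
  by case: (b); case: (c); case: (s); case: (t).
have -> // : ((if a then b else ~~ b) == ~~ (b == t)) = a (+) t.
by case: (a); case: (b); case: (t).
Qed.

Let edgeT : rho w (j, t) = rho w (i.+1, ~~ s) /\ rho w (j.+2, t) = rho w (i.+1, ~~ s).
Proof.
have := cornerP false false true; have := cornerP true false true.
by case: (s == t); rewrite /= ?addn0 ?addn1 => -> ->.
Qed.

Let edgeU : rho w (i, s) = rho w (j.+1, ~~ t) /\ rho w (i.+2, s) = rho w (j.+1, ~~ t).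
Proof.
have := cornerP false true false; have := cornerP true true false.
by case: (s == t); rewrite /= ?addn0 ?addn1 => -> ->.
Qed.

Let L := rho w (i, ~~ s).
Let R := rho w (i.+2, ~~ s).

Let edgeLR : rho w (j, ~~ t) = (if s == t then R else L) /\
             rho w (j.+2, ~~ t) = (if s == t then L else R).
Proof.
have := cornerP false true true; have := cornerP true true true.
by case: (s == t); rewrite /= ?addn0 ?addn1 /L /R => -> ->.
Qed.

(* The colouring of [w'], with [i] and [k] the edges of the separated strands. *)
Let f x := merge L R (rho w x).

Let mergeL : merge L R L = L. Proof. by rewrite /merge if_same. Qed.
Let mergeR : merge L R R = L. Proof. by rewrite /merge eqxx. Qed.

Let boolN (r r' : bool) : r = r' \/ r = ~~ r'.
Proof. by case: r; case: r'; auto. Qed.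

(** The edges [i] and [i.+2] become one edge of [w']; on the side [~~ s] this forces the
    identification of [L] and [R]. *)
Let f_i r : f (i, r) = f (i.+2, r).
Proof.
have [e1 e2] := edgeU; rewrite /f.
by have [->|->] := boolN r s; rewrite ?e1 ?e2 // -/L -/R mergeL mergeR.
Qed.

Let f_j r : f (j, r) = f (j.+2, r).
Proof.
have [e1 e2] := edgeT; have [e3 e4] := edgeLR; rewrite /f.
have [->|->] := boolN r t; rewrite ?e1 ?e2 // e3 e4.
by case: ifP; rewrite mergeL mergeR.
Qed.

Let k := size (w0 ++ w1).
Let g x := f (skip_edge i x.1, x.2).
Let h x := g (skip_edge k x.1, x.2).

Let jk : j = k.+2. Proof. by rewrite /j /k size_cat. Qed.
Let ik : (i <= k)%N. Proof. by rewrite /k size_cat leq_addr. Qed.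

Let gE n (b : bool) r : g (n + b, r)%N = f (skip i n + b, r)%N.
Proof. by rewrite /g /=; apply: skip_edgeE. Qed.

Let skip_ge n : (k <= n)%N -> skip i n = n.+2.
Proof. by rewrite /skip; have := ik; case: ltnP => //; lia. Qed.

Let hE n (b : bool) r : h (n + b, r)%N = f (skip i (skip k n) + b, r)%N.
Proof.
rewrite /h /= skip_edgeE ?gE // => r'.
have := gE k false r'; have := gE k.+2 false r'; rewrite !addn0 => -> ->.
by rewrite !skip_ge ?leqnSn //; [rewrite -jk f_j | lia].
Qed.

Let index_w q : q \in w' -> index q w = skip i (skip k (index q w')).
Proof.
move=> qw'; have uw := gauss_uniq gw.
have wE : w' = (w0 ++ w1) ++ w2 by rewrite /w' catA.
have qP : q \notin [:: p1; p2].
  apply: (insert_uniq uw); move: qw'; rewrite /w' !mem_cat.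
  by case/or3P => ->; rewrite ?orbT.
have qQ : q \notin [:: q1; q2].
  rewrite wQ in uw; apply: (insert_uniq uw); move: qw'; rewrite /w' !mem_cat.
  by case/or3P => ->; rewrite ?orbT.
by rewrite /w index_insert // catA index_insert // wE.
Qed.

Let col' : colouring w' h.
Proof.
have [h0 hn hc] := colouring_rho gw.
split.
- by rewrite /h /g /f /skip_edge /= h0.
- have := hE (size w') false; rewrite !addn0 => eh; rewrite !eh.
  have kw : (k <= size w')%N by rewrite /k /w' !size_cat; lia.
  have -> : skip i (skip k (size w')) = size w.
    rewrite {2}/skip ltnNge kw /= skip_ge ?size_w //; lia.
  by rewrite /f hn.
move=> q qw' a b; rewrite !hE -!index_w ?gauss_other // /f hc //.
by move: qw'; rewrite /w /w' !mem_cat => /or3P [] ->; rewrite ?orbT.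
Qed.

Let h_attains e r : (e <= size w)%N -> e != i.+1 -> e != j.+1 ->
  exists2 n, (n <= size w')%N & h (n, r) = f (e, r).
Proof.
have kw : (k <= size w')%N by rewrite /k /w' catA [X in (_ <= X)%N]size_cat leq_addr.
have ew : size w = (size w').+4 by exact: size_w.
move: ew kw ik; rewrite jk; move: (size w) (size w') => m m' -> kw' ik' em ei ej.
have [ei'|ei'] := leqP e i.
  exists e; first by lia.
  by rewrite /h /g /skip_edge /= (leq_trans ei' ik') ei'.
have [n en] : exists n, e = n.+2 by exists e.-2; lia.
subst e; have [ek|ek] := leqP n k.
  exists n; first by lia.
  rewrite /h /g /skip_edge /= ek; case: leqP => // e2.
  have -> : n = i by lia.
  by rewrite f_i.
have [l en] : exists l, n = l.+2 by exists n.-2; lia.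
subst n; exists l; first by lia.
rewrite /h /g /skip_edge /=; case: (leqP l k) => e2; last by rewrite ifF //; lia.
have -> : l = k by lia.
have kf : f (k.+2, r) = f (k.+4, r) by rewrite -jk f_j.
(* When [w1] is empty, [k = i] and the edges [i], [j] (which is [i.+2]) and [j.+2] all become one
   edge. *)
by case: leqP => // ki; rewrite -kf; have -> : k = i by lia; rewrite f_i.
Qed.

Let D := [seq p <- w' | over p].
Let Dw' : crossing_list w' D := crossing_list_gauss gw'.

Let Dw : crossing_list w [:: P false, P true & D].
Proof.
apply: perm_trans (crossing_list_cons _ (crossing_list_cons _ Dw')) _.
apply: perm_trans (perm_strands w0 w1 w2 p1 p2 q1 q2).
rewrite !otherP /P perm_cons (perm_catCA [:: _] [:: _]) perm_cons.
by case: (s == t); rewrite /Q //= perm_cons2.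
Qed.

Let regions_w : #|regions w| = (size D).+3.
Proof. by rewrite (card_regions gw Dw sw). Qed.

Let rs := rem d (enum (regions w)).

Let size_rs : size rs = (size D).+2.
Proof.
by rewrite size_rem ?mem_enum ?region_of_regions // -cardE regions_w.
Qed.

Let uniq_rs : uniq rs. Proof. by rewrite rem_uniq ?enum_uniq. Qed.

Let mem_rs (r : {set side w}) : (r \in rs) = (r != d) && (r \in regions w).
Proof. by rewrite mem_rem_uniq ?enum_uniq // inE mem_enum. Qed.

Let rho_rs e r : (e <= size w)%N -> e != i.+1 -> e != j.+1 -> rho w (e, r) \in rs.
Proof.
move=> ew ei ej; rewrite mem_rs region_of_regions andbT faceE //.
by rewrite !inE !xpair_eqE (negPf ei) (negPf ej).
Qed.

(** The middle edges of the two strands disappear, but the region across each of them also borders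
    an outer edge of the opposite strand. *)
Let attains_rs r : r \in rs ->
  exists z : nat * bool, (z.1 <= size w')%N /\ h z = merge L R r.
Proof.
rewrite mem_rs => /andP [rd]; rewrite -mem_enum => /(@attains_rho w) [[e u] /= [ew er]].
suff [e' [u' [ew' ei ej er']]] : exists e' u', [/\ (e' <= size w)%N, e' != i.+1,
    e' != j.+1 & rho w (e', u') = r].
  by have [n nw hn] := h_attains u' ew' ei ej; exists (n, u'); rewrite hn /f er'.
have [le_iw [le_ij le_jw]] := ijw.
have [ei|ei] := eqVneq e i.+1.
  exists j, t; split; rewrite ?(gtn_eqF le_ij) ?(ltn_eqF (leqnn _)) //.
    by rewrite (leq_trans _ le_jw) // leqW.
  rewrite -er ei (proj1 edgeT); congr (rho w (_, _)).
  have [us|->//] := boolN u s.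
  by move: rd; rewrite -er faceE // ei us mem_head.
have [ej|ej] := eqVneq e j.+1; last by exists e, u.
have ij : (i < j.+1)%N by rewrite (leq_trans _ (leqW le_ij)) // leqW.
exists i, s; split; rewrite ?ltn_eqF //.
rewrite -er ej (proj1 edgeU); congr (rho w (_, _)).
have [ut|->//] := boolN u t.
by move: rd; rewrite -er faceE // ej ut !inE eqxx orbT.
Qed.

Let LR : L != R.
Proof.
apply/eqP => eLR.
(* With [L = R] the merging is trivial, so [h] would keep all [size D + 2] colours of [rs], one too
   many for [w']. *)
have att : attains w' h rs.
  by move=> r /attains_rs [z [zw hz]]; exists z; rewrite hz /merge eLR; case: eqP.
have := size_colours gw' Dw' sw' col' uniq_rs att.
by rewrite size_rs ltnn.
Qed.

Let vertexP b c : c = b (+) (s == t) ->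
  perm_eq (vertex w (rho w) (P b))
    [:: (corner_label W (over p1 == (b == t)) (~~ b) (~~ c), d);
        (corner_label W (over p1 == (b == t)) (~~ b) c, rho w (i.+1, ~~ s));
        (corner_label W (over p1 == (b == t)) b (~~ c), rho w (j.+1, ~~ t));
        (corner_label W (over p1 == (b == t)) b c, if b then R else L)].
Proof.
move=> ec; apply: perm_trans (vertex_perm _ _ _ b (~~ c)) _.
rewrite /= negbK indexP positive_eps epsP.
have -> : over (P b) = over p1 by rewrite /P; case: b {ec}.
have -> : (c == (b == t)) = ~~ s by rewrite ec; case: b {ec}; case: (s); case: (t).
have -> : (~~ c == (b == t)) = s by rewrite ec; case: b {ec}; case: (s); case: (t).
have -> : (i + b + ~~ b = i.+1)%N by case: b {ec}; rewrite /= ?addn1 ?addn0.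
have/eqP -> : rho w (i.+1, s) == d.
  by rewrite faceE ?mem_head //; apply: i1w.
have -> : rho w (i + b + b, s)%N = rho w (j.+1, ~~ t).
  have [e1 e2] := edgeU; case: b {ec}; rewrite /= ?addn1 ?addn0 //.
have -> // : rho w (i + b + b, ~~ s)%N = if b then R else L.
by case: b {ec}; rewrite /= ?addn1 ?addn0.
Qed.

Lemma nabla_bigon : nabla w = nabla w'.
Proof.
have LRw := LR.
have [le_iw [le_ij le_jw]] := ijw.
(* Merging replaces [R] by [L], and the other [size D + 1] regions remain as colours. *)
pose vals := rem R rs.
have ij : (i.+2 < j.+1)%N by [].
have ij' : (i < j.+1)%N by rewrite ltnW // ltnW.
have iw : (i.+2 <= size w)%N by rewrite (leq_trans le_ij) // ltnW // ltnW.
have Rrs : R \in rs by apply: rho_rs; rewrite ?(gtn_eqF (ltnSn _)) ?ltn_eqF.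
have Lrs : L \in rs by apply: rho_rs; rewrite ?ltn_eqF.
have att : attains w' h vals.
  move=> r; rewrite mem_rem_uniq // inE => /andP [rR rrs].
  by have [z [zw hz]] := attains_rs rrs; exists z; rewrite hz merge_id.
have full : (size D < size vals)%N by rewrite size_rem // size_rs.
rewrite (nabla_rho gw sw Dw).
rewrite (nabla_colouring gw' Dw' sw' col' (rem_uniq _ uniq_rs) att full).
have -> : map (vertex w' h) D = map (merge_vertex L R) (map (vertex w (rho w)) D).
  rewrite -map_comp; apply/eq_in_map => q; rewrite mem_filter => /andP [_ qw'].
  rewrite /merge_vertex /vertex -[RHS]map_comp; apply: eq_map => m /=.
  by rewrite hE -index_w.
rewrite [h (0, true)%N](_ : _ = merge L R (rho w (0, true)%N)) //.
rewrite [map _ _]/=; apply: etrans (statesum_congr _ (vertexP (b := false) erefl)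
  (fun u => statesum_congr u (vertexP (b := true) erefl) (frefl _))) _.
have [l1 l2 l3 l4] := bigon_labels (over p1) s t W_neq0.
apply: (statesum_bigon (rs := rs) _ _ _ _ LRw _ l1 l2 l3 l4).
- apply/allP => _ /mapP [q + ->]; rewrite mem_filter => /andP [_ qw'].
  apply/allP => _ /mapP [m _ ->] /=; apply: rho_rs.
  + apply: index_bound; move: qw'; rewrite /w /w' !mem_cat.
    by case/or3P => ->; rewrite ?orbT.
  + by rewrite index_w // skip_neq.
  + by rewrite index_w // jk skip_skip_neq // ik.
- by rewrite mem_rs eqxx.
- exact: rho_rs.
- rewrite /= Lrs Rrs -(proj1 edgeT) -(proj1 edgeU) !rho_rs //.
  + by rewrite ltn_eqF.
  + by rewrite ltn_eqF.
  + by rewrite (leq_trans _ le_jw) // leqW.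
  + by rewrite gtn_eqF.
  + by rewrite ltn_eqF.
- by rewrite size_map size_rs.
Qed.

End Bigon.

Lemma mock_RII (K K' : knotoid_diagram) :
  RII K K' -> mock_alexander K = mock_alexander K'.
Proof.
case: K K' => w gw sw [w' gw' sw'] /= [w0 [w1 [w2 [p1 [p2 [q1 [q2 [s [t]]]]]]]]] /=.
rewrite /mock_alexander /= addn3 => -[ew o12 xy ew']; subst w w'.
exact: (nabla_bigon gw sw gw' sw' o12 xy).
Qed.

(** * The third move *)

Inductive strand := S1 | S2 | S3.

(** Any two strands of the triangle cross, so either cyclic order of the three can be used. *)
Definition next t := match t with S1 => S2 | S2 => S3 | S3 => S1 end.

Lemma next3 t : next (next (next t)) = t. Proof. by case: t. Qed.

Lemma perm_pairs (T : eqType) (f g h : bool -> T) (a b c : bool) :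
  perm_eq [:: f a; g (~~ b); g b; h (~~ c); h c; f (~~ a)]
          [:: f false; f true; g false; g true; h false; h true].
Proof. by apply/permP => p; case: a; case: b; case: c => /=; lia. Qed.

Section Triangle.
Variables (w w' rest : code) (n : strand -> nat) (s y : strand -> bool).
Variables (P : strand -> bool -> passage) (d : {set side w}).
Hypotheses (gw : gauss_code w) (sw : spherical w).
Hypotheses (gw' : gauss_code w') (sw' : spherical w').
Hypothesis size_w' : size w' = size w.
Hypothesis perm_w : perm_eq [:: P S1 false, P S1 true, P S2 false, P S2 true,
  P S3 false, P S3 true & rest] w.
Hypothesis perm_w' : perm_eq w' w.
Hypothesis indexP : forall t b, index (P t b) w = (n t + b)%N.
Hypothesis indexP' : forall t b, index (P t b) w' = (n t + ~~ b)%N.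
Hypothesis index_rest : {in rest, forall q, index q w' = index q w}.
Hypothesis n_inj : forall t t', n t = n t' -> t = t'.
Hypothesis n_apart : forall t t', n t <> (n t').+1.
Hypothesis n_le : forall t, ((n t).+2 <= size w)%N.
Hypothesis d_region : d \in regions w.
Hypothesis face : forall m : nat * bool, (m.1 <= size w)%N ->
  rho w m = d <-> exists t, m = ((n t).+1, s t).

(* The crossings of the triangle are those of the strands [t] and [next t]; the
   strand [t] meets this one at its passage [P t (y t)]. *)
Let e t := eps (P t (y t)).
Let o t := over (P t (y t)).
Hypothesis otherP : forall t, other (P t (y t)) = P (next t) (~~ y (next t)).
Hypothesis se : forall t, s t = (y (next t) == e t).
Hypothesis se' : forall t, s (next t) = (y t == e t).
Hypothesis o_layered : ~~ [&& o S1, o S2 & o S3] && [|| o S1, o S2 | o S3].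

Let mem_w : w' =i w. Proof. exact: perm_mem. Qed.

Let memP t b : P t b \in w.
Proof.
by rewrite -(perm_mem perm_w) !inE; case: t; case: b; rewrite eqxx ?orbT.
Qed.

Let addbNb k (b : bool) : (k + b + ~~ b)%N = k.+1 /\ (k + ~~ b + b)%N = k.+1.
Proof. by case: b; rewrite /= ?addn0 ?addn1. Qed.

(** The numbers [n t + b + b] are the outer edges [n t] and [(n t).+2] of a strand; they may be
    outer edges of another strand too, but never middle ones. *)
Let mid_neq t t' (b : bool) : (n t + b + b)%N != (n t').+1.
Proof.
apply/eqP; case: b; rewrite ?addn1 ?addn0; last exact: n_apart.
by move=> [] /esym; apply: n_apart.
Qed.

Let out_le t (b : bool) : (n t + b + b <= size w)%N.
Proof.
by have := n_le t; case: b; rewrite ?addn1 ?addn0 // => /ltnW /ltnW.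
Qed.

Let corner t (a b : bool) : rho w (n t + y t + a, b == e t)%N =
  rho w (n (next t) + ~~ y (next t) + b, a == ~~ e t)%N.
Proof.
have [_ _ hc] := colouring_rho gw.
by have := hc _ (memP t (y t)) a b; rewrite otherP !indexP.
Qed.

(* The regions outside the triangle across the side of strand [t], and at the
   vertex of the strands [t] and [next t]. *)
Let E t := rho w ((n t).+1, ~~ s t).
Let V t := rho w (n t + y t + y t, ~~ s t)%N.

Let cornerV t :
  rho w (n (next t) + ~~ y (next t) + ~~ y (next t), ~~ s (next t))%N = V t.
Proof.
have := corner t (y t) (~~ y (next t)).
have -> : (~~ y (next t) == e t) = ~~ s t by rewrite se; case: y; case: e.
have -> // : (y t == ~~ e t) = ~~ s (next t) by rewrite se'; case: y; case: e.
Qed.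

Let cornerE t :
  rho w (n (next t) + ~~ y (next t) + ~~ y (next t), s (next t))%N = E t.
Proof.
have := corner t (~~ y t) (~~ y (next t)).
have -> : (~~ y (next t) == e t) = ~~ s t by rewrite se; case: y; case: e.
have -> : (~~ y t == ~~ e t) = s (next t) by rewrite se'; case: y; case: e.
by rewrite (proj1 (addbNb _ _)).
Qed.

Let cornerE' t : rho w (n t + y t + y t, s t)%N = E (next t).
Proof.
have := corner t (y t) (y (next t)); rewrite -se.
have -> : (y t == ~~ e t) = ~~ s (next t) by rewrite se'; case: y; case: e.
by rewrite (proj2 (addbNb _ _)).
Qed.

Let cornerV3 t : rho w (n t + ~~ y t + ~~ y t, ~~ s t)%N = V (next (next t)).
Proof. by have := cornerV (next (next t)); rewrite next3. Qed.

Let cornerE3 t : rho w (n t + ~~ y t + ~~ y t, s t)%N = E (next (next t)).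
Proof. by have := cornerE (next (next t)); rewrite next3. Qed.

Let faceP t : rho w ((n t).+1, s t) = d.
Proof. by apply/face; [apply: ltnW (n_le t) | exists t]. Qed.

Let is_mid (k : nat) t := k == (n t).+1.
(** In [w'] the middle edge of [t] has passed the crossing of the two other strands, so its side
    [s t] faces the region at that vertex, [V (next t)]. *)
Let mid_colour t (b : bool) := if b == s t then V (next t) else d.
(* The triangle of [w'] lies on the other side of the three strands. *)
Let h (x : nat * bool) :=
  if is_mid x.1 S1 then mid_colour S1 x.2 else
  if is_mid x.1 S2 then mid_colour S2 x.2 else
  if is_mid x.1 S3 then mid_colour S3 x.2 else rho w x.

Let h_mid t b : h ((n t).+1, b) = mid_colour t b.
Proof.
rewrite /h /is_mid /= !eqSS.
by case: t; rewrite ?eqxx //; do ! case: eqP => [/n_inj //|_].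
Qed.

Let h_out k b : (forall t, k != (n t).+1) -> h (k, b) = rho w (k, b).
Proof. by move=> kn; rewrite /h /is_mid /= !(negPf (kn _)). Qed.

Let six := [:: P S1 false; P S1 true; P S2 false; P S2 true;
  P S3 false; P S3 true].

Let six_cat : six ++ rest = [:: P S1 false, P S1 true, P S2 false, P S2 true,
  P S3 false, P S3 true & rest].
Proof. by []. Qed.

Let rest_P q t b : q \in rest -> q != P t b.
Proof.
move=> qr; apply/eqP => qe; subst q.
have : uniq (six ++ rest) by rewrite (perm_uniq perm_w) gauss_uniq.
rewrite cat_uniq => /and3P [_ /hasPn /(_ _ qr) + _].
by rewrite !inE; case: t {qr}; case: b; rewrite eqxx ?orbT.
Qed.

Let w_cases q : q \in w -> (exists t b, q = P t b) \/ q \in rest.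
Proof.
rewrite -(perm_mem perm_w) -six_cat mem_cat => /orP [|->]; last by right.
by rewrite !inE => /or4P [||| /or3P []] /eqP ->; left;
  [exists S1, false | exists S1, true | exists S2, false | exists S2, true
  | exists S3, false | exists S3, true].
Qed.

Let rest_w q : q \in rest -> q \in w.
Proof. by move=> qr; rewrite -(perm_mem perm_w) -six_cat mem_cat qr orbT. Qed.

Let rest_neq q t (a : bool) : q \in rest -> (index q w + a != (n t).+1)%N.
Proof.
move=> qr; apply/eqP => ie.
have : index q w = index (P t (~~ a)) w.
  by move: ie; rewrite indexP; case: a; rewrite /= ?addn0 ?addn1 // => -[].
move/(index_mem_inj (rest_w qr)) => qe.
by have := rest_P t (~~ a) qr; rewrite qe eqxx.
Qed.

Let otherP' t : P t (~~ y t) = other (P (next (next t)) (y (next (next t)))).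
Proof. by rewrite otherP next3. Qed.

Let other_rest q : (other q \in rest) = (q \in rest).
Proof.
suff rr p : p \in rest -> other p \in rest.
  by apply/idP/idP => /rr //; rewrite otherK.
move=> pr; have : other p \in w by rewrite gauss_other ?rest_w.
case/w_cases => // -[t [b pe]]; have : p = other (P t b) by rewrite -pe otherK.
have [->|->] : b = y t \/ b = ~~ y t by case: b {pe}; case: y; auto.
  by rewrite otherP => /eqP; rewrite (negPf (rest_P _ _ pr)).
by rewrite otherP' otherK => /eqP; rewrite (negPf (rest_P _ _ pr)).
Qed.

Let corner' t : corner_colour w' h (P t (y t)).
Proof.
move=> a b; rewrite otherP !indexP' negbK -/(e t); set u := next t.
(* In [w'] the middle edges are in the directions [a = y t] and [b = ~~ y u], the reverse of those
   in [w]. *)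
have [->|->] : a = y t \/ a = ~~ y t by case: a; case: y; auto.
  rewrite (proj2 (addbNb _ _)).
  have -> : (y t == ~~ e t) = ~~ s u by rewrite se'; case: y; case: e.
  have [->|->] : b = y u \/ b = ~~ y u by case: b; case: y; auto.
    by rewrite -se h_mid /mid_colour eqxx h_out.
  have -> : (~~ y u == e t) = ~~ s t by rewrite se; case: y; case: e.
  by rewrite (proj1 (addbNb _ _)) !h_mid /mid_colour; case: (s t); case: (s u).
have -> : (~~ y t == ~~ e t) = s u by rewrite se'; case: y; case: e.
have [->|->] : b = y u \/ b = ~~ y u by case: b; case: y; auto.
  by rewrite -se !h_out // cornerE' cornerE3.
have -> : (~~ y u == e t) = ~~ s t by rewrite se; case: y; case: e.
by rewrite (proj1 (addbNb _ _)) h_mid /mid_colour eqxx h_out // cornerV3.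
Qed.

Let col' : colouring w' h.
Proof.
have [h0 hn hc] := colouring_rho gw.
split.
- by rewrite !h_out.
- by rewrite size_w' !h_out // => t; rewrite gtn_eqF //; apply: n_le.
move=> q; rewrite mem_w => /w_cases [[t [b ->]]|qr a b].
  have [->|->] : b = y t \/ b = ~~ y t by case: b; case: y; auto.
    exact: corner'.
  by rewrite otherP'; apply/corner_colour_other/corner'.
by rewrite !index_rest ?other_rest // !h_out ?hc ?rest_w // => t; apply: rest_neq;
  rewrite ?other_rest.
Qed.

(** Only sides of middle edges change colour: [d] reappears on the other side of the same edge, and
    [E t] is found on an outer edge of [next t]. *)
Let att : attains w' h (enum (regions w)).
Proof.
move=> r /(@attains_rho w) [[k b] /= [kw <-]].
suff [k' [b' [kw' hk]]] : exists k' b', (k' <= size w)%N /\ h (k', b') = rho w (k, b).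
  by exists (k', b'); rewrite size_w'.
have mid t : k = (n t).+1 ->
    exists k' b', (k' <= size w)%N /\ h (k', b') = rho w (k, b).
  move=> kt; have [bs|bs] : b = s t \/ b = ~~ s t by case: b; case: (s t); auto.
    exists k, (~~ s t); rewrite kt bs h_mid /mid_colour faceP; split.
      exact: ltnW (n_le t).
    by case: (s t).
  exists (n (next t) + ~~ y (next t) + ~~ y (next t))%N, (s (next t)).
  by rewrite out_le h_out // cornerE kt bs.
case: (eqVneq k (n S1).+1) => [/mid //|k1].
case: (eqVneq k (n S2).+1) => [/mid //|k2].
case: (eqVneq k (n S3).+1) => [/mid //|k3].
by exists k, b; rewrite h_out // => -[].
Qed.

Let D := [seq q <- rest | over q].

Let Dw : crossing_list w [:: P S1 (y S1), P S2 (y S2), P S3 (y S3) & D].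
Proof.
have urest : uniq rest.
  have : uniq (six ++ rest) by rewrite (perm_uniq perm_w) gauss_uniq.
  by rewrite cat_uniq => /and3P [].
have Dr : crossing_list rest D by apply: crossing_list_over.
apply: perm_trans (crossing_list_cons _ (crossing_list_cons _
  (crossing_list_cons _ Dr))) _.
have p6 : perm_eq [:: P S1 (y S1); P S2 (~~ y S2); P S2 (y S2); P S3 (~~ y S3);
    P S3 (y S3); P S1 (~~ y S1)] six.
  exact: perm_pairs.
rewrite -(perm_cat2r rest) in p6.
by apply: perm_trans perm_w; rewrite !otherP.
Qed.

Let Dw' : crossing_list w' [:: P S1 (y S1), P S2 (y S2), P S3 (y S3) & D].
Proof. by apply: perm_trans Dw _; rewrite perm_sym. Qed.

Let regions_w : #|regions w| = (size D).+4.
Proof. by rewrite (card_regions gw Dw sw). Qed.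

Let rs := rem d (enum (regions w)).

Let size_rs : size rs = (size D).+3.
Proof. by rewrite size_rem ?mem_enum // -cardE regions_w. Qed.

Let mem_rs (r : {set side w}) : (r \in rs) = (r != d) && (r \in regions w).
Proof. by rewrite mem_rem_uniq ?enum_uniq // inE mem_enum. Qed.

Let rho_rs k b : (k <= size w)%N -> (forall t, k != (n t).+1) ->
  rho w (k, b) \in rs.
Proof.
move=> kw kn; rewrite mem_rs region_of_regions andbT.
apply/eqP => /face [] // t [kt _].
by have := kn t; rewrite kt eqxx.
Qed.

Let V_rs t : V t \in rs. Proof. exact: rho_rs. Qed.
Let E_rs t : E t \in rs. Proof. by rewrite -cornerE; apply: rho_rs. Qed.

Let l t a b := corner_label W (o t == e t) a b.

Let vertexP t : perm_eq (vertex w (rho w) (P t (y t)))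
  (let u := next t in
   [:: (l t (~~ y t) (y u), d); (l t (~~ y t) (~~ y u), E t);
       (l t (y t) (y u), E u); (l t (y t) (~~ y u), V t)]).
Proof.
set u := next t.
apply: perm_trans (vertex_perm _ _ _ (y t) (y u)) _.
rewrite /= indexP positive_eps -/(e t) -/(o t) -/(l t _ _) -se cornerE'.
have -> : (~~ y u == e t) = ~~ s t by rewrite se; case: y; case: e.
by rewrite (proj1 (addbNb _ _)) faceP.
Qed.

Let vertexP' t : perm_eq (vertex w' h (P t (y t)))
  (let u := next t in let v := next u in
   [:: (l t (~~ y t) (y u), E v); (l t (~~ y t) (~~ y u), V v);
       (l t (y t) (y u), V u); (l t (y t) (~~ y u), d)]).
Proof.
set u := next t; set v := next u.
apply: perm_trans (vertex_perm _ _ _ (y t) (y u)) _.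
rewrite /= indexP' positive_eps -/(e t) -/(o t) -/(l t _ _) -se.
have -> : (~~ y u == e t) = ~~ s t by rewrite se; case: y; case: e.
rewrite (proj2 (addbNb _ _)) !h_mid /mid_colour eqxx !h_out //.
rewrite cornerE3 cornerV3.
by have -> : (~~ s t == s t) = false by case: (s t).
Qed.

Lemma nabla_triangle : nabla w = nabla w'.
Proof.
case/andP: o_layered => o1 o2.
have full : (size [:: P S1 (y S1), P S2 (y S2), P S3 (y S3) & D] <
             size (enum (regions w)))%N by rewrite -cardE regions_w.
rewrite (nabla_rho gw sw Dw).
rewrite (nabla_colouring gw' Dw' sw' col' (enum_uniq _) att full).
have h0 : h (0, true)%N = rho w (0, true)%N by apply: h_out.
rewrite h0 {h0}.
have hD : map (vertex w' h) D = map (vertex w (rho w)) D.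
  apply/eq_in_map => q; rewrite mem_filter => /andP [_ qr].
  apply: eq_map => m; rewrite index_rest // h_out // => t.
  exact: rest_neq.
rewrite ![map _ [:: _, _, _ & _]]/= hD; set vs := map _ D.
apply: etrans (statesum_congr _ (vertexP S1) (fun u1 =>
  statesum_congr u1 (vertexP S2) (fun u2 =>
  statesum_congr u2 (vertexP S3) (frefl _)))) _.
apply: etrans _ (esym (statesum_congr _ (vertexP' S1) (fun u1 =>
  statesum_congr u1 (vertexP' S2) (fun u2 =>
  statesum_congr u2 (vertexP' S3) (frefl _))))).
have vs_rs : all (fun v => all (fun m => m.2 \in rs) v) vs.
  apply/allP => _ /mapP [q + ->]; rewrite mem_filter => /andP [_ qr].
  apply/allP => _ /mapP [m _ ->] /=; apply: rho_rs.
    exact/index_bound/rest_w.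
  by move=> t; apply: rest_neq.
have d_rs : d \notin rs by rewrite mem_rs eqxx.
have star_rs : rho w (0, true)%N \in rs by apply: rho_rs.
apply: (statesum_triangle W_neq0 vs_rs d_rs star_rs _ _ _ _ _ o1 o2).
- by rewrite /= !E_rs !V_rs.
- by rewrite size_rs size_map.
- by rewrite -(se S1) -(se' S3).
- by rewrite -(se S2) -(se' S1).
- by rewrite -(se S3) -(se' S2).
Qed.

End Triangle.

Lemma rho_colouring (T : eqType) w (h : nat * bool -> T) (x y : nat * bool) :
  gauss_code w -> colouring w h -> (x.1 <= size w)%N -> (y.1 <= size w)%N ->
  rho w x = rho w y -> h x = h y.
Proof.
move=> gw hw xw yw /(side_colour_region gw hw).
by rewrite !side_colour_mk // -!surjective_pairing.
Qed.

(** * The pairing of passages around a triangular face *)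

Section Mates.
Variables (w : code) (n : strand -> nat) (s : strand -> bool).
Variables (P : strand -> bool -> passage) (d : {set side w}).
Hypothesis gw : gauss_code w.
Hypothesis wP : forall t, exists u v,
  w = u ++ [:: P t false; P t true] ++ v /\ size u = n t.
Hypothesis n_inj : forall t t', n t = n t' -> t = t'.
Hypothesis n_apart : forall t t', n t <> (n t').+1.
Hypothesis n_le : forall t, ((n t).+2 <= size w)%N.
Hypothesis face : forall m : nat * bool, (m.1 <= size w)%N ->
  rho w m = d <-> exists t, m = ((n t).+1, s t).
Hypothesis overP : exists t, over (P t false) && over (P t true).

Lemma index_strands t b : index (P t b) w = (n t + b)%N.
Proof.
have [u [v [we <-]]] := wP t.
have := @index_strand (P t false) (P t true) u v b.
by rewrite -we => /(_ (gauss_uniq gw)); case: b.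
Qed.

Let memP t b : P t b \in w.
Proof.
by have [u [v [-> _]]] := wP t; rewrite !mem_cat !inE; case: b; rewrite eqxx ?orbT.
Qed.

Let P_inj t t' b b' : P t b = P t' b' -> t = t' /\ b = b'.
Proof.
move/(congr1 (index^~ w)); rewrite /= !index_strands.
case: b; case: b'; rewrite /= ?addn0 ?addn1.
- by move=> [/n_inj].
- by move/esym/n_apart.
- by move/n_apart.
- by move/n_inj.
Qed.

(** Turning around the corner of the face at [P t b] leads to one of the three listed sides, so the
    partner is an end of a middle edge. *)
Let mid_mate t b : exists t', other (P t b) = P t' (~~ (s t == eps (P t b))) /\
  s t' = (b == eps (P t b)).
Proof.
have [_ _ hc] := colouring_rho gw; set e := eps _.
have := hc _ (memP t b) (~~ b) (s t == e); rewrite index_strands.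
have -> : (n t + b + ~~ b)%N = (n t).+1 by case: b {e}; rewrite /= ?addn0 ?addn1.
rewrite -/e; have -> : ((s t == e) == e) = s t by case: (s t); case: e.
have -> : (~~ b == ~~ e) = (b == e) by case: (b); case: e.
have -> : rho w ((n t).+1, s t) = d.
  by apply/face; [apply: ltnW (n_le t) | exists t].
move/esym/face => []; first by apply: index_bound; rewrite gauss_other.
move=> t' [ie se]; exists t'; split; last by rewrite se.
apply: index_mem_inj; first by rewrite gauss_other.
rewrite index_strands; case: (s t == e) ie; rewrite /= ?addn0 ?addn1 //.
by case.
Qed.

(** A kink would make [d] a monogon. The colouring with [None] on the monogon and [Some tt]
    elsewhere separates the side on [t] from the one on [next t], although both border [d]. *)
Lemma no_kink t : other (P t false) <> P t true.
Proof.
move=> pk; have [u [v [we un]]] := wP t; rewrite -pk in we.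
set p := P t false in pk we.
have col : colouring w (kink u p (fun=> tt)).
  have gw' := gw; rewrite we in gw'; rewrite {1}we.
  exact: (@colouring_kink _ u v p (fun=> tt) gw').
have dt t' : rho w ((n t').+1, s t') = d.
  by apply/face; [apply: ltnW (n_le t') | exists t'].
have := rho_colouring gw col _ _ (etrans (dt t) (esym (dt (next t)))).
rewrite /= /kink /= un eqxx eqSS.
have -> : (n (next t) == n t) = false.
  by apply/eqP => /n_inj; case: (t).
have [t' [pt st]] := mid_mate t false.
move: pt; rewrite pk => /P_inj [_ /esym /negbTE].
rewrite -/p => ->; move: (n_le t) (n_le (next t)) => h1 h2.
by move=> /(_ (ltnW h1) (ltnW h2)).
Qed.

Let mate t b : exists2 t', t' <> t &
  other (P t b) = P t' (~~ (s t == eps (P t b))) /\ s t' = (b == eps (P t b)).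
Proof.
have [t' [ot st]] := mid_mate t b; exists t' => // tt'; subst t'.
move: ot; set c := ~~ _; have [->|->] : c = b \/ c = ~~ b by case: (c); case: (b); auto.
  by move/(congr1 over); case: (P t b) => [[? []]].
case: (b) => /= ot; last exact: (no_kink ot).
by apply: (no_kink (t := t)); rewrite -ot otherK.
Qed.

Let third (t t' : strand) : t' <> t -> t' = next t \/ t' = next (next t).
Proof. by case: t; case: t' => //; auto. Qed.

(** If two strands shared both their crossings, the third would have no other strand to meet. *)
Let not_both t t' c c' : t' <> t -> other (P t false) = P t' c ->
  other (P t true) = P t' c' -> False.
Proof.
move=> tt' e e'.
have cc' : c' = ~~ c.
  have : c' <> c.
    move=> cc; move: e'; rewrite cc -e => /(can_inj otherK) /P_inj [_ //].
  by case: (c); case: (c').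
have et b : exists b', other (P t b) = P t' b'.
  by case: b; [exists c' | exists c].
have et' b : exists b', other (P t' b) = P t b'.
  have [->|->] : b = c \/ b = c' by rewrite cc'; case: (b); case: (c); auto.
    by exists false; rewrite -e otherK.
  by exists true; rewrite -e' otherK.
have [t'' n1 n2] : exists2 t'', t'' <> t & t'' <> t'.
  by move: tt'; case: t {e e' et et'}; case: t' => // _;
    [exists S3 | exists S2 | exists S3 | exists S1 | exists S2 | exists S1].
have [t3 n3 [o3 _]] := mate t'' false; set c3 := ~~ _ in o3.
have [t3t|t3t] : t3 = t \/ t3 = t'.
  by move: n1 n2 n3 tt'; case: (t); case: (t'); case: (t''); case: (t3); auto.
  have [b' eb] := et c3.
  have := etrans (esym (otherK (P t'' false))) (congr1 other o3).
  by rewrite t3t eb => /P_inj [].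
have [b' eb] := et' c3.
have := etrans (esym (otherK (P t'' false))) (congr1 other o3).
by rewrite t3t eb => /P_inj [].
Qed.

Lemma triangle_mates : exists y : strand -> bool,
  let e t := eps (P t (y t)) in
  let o t := over (P t (y t)) in
  [/\ forall t, other (P t (y t)) = P (next t) (~~ y (next t)),
      forall t, s t = (y (next t) == e t),
      forall t, s (next t) = (y t == e t)
    & ~~ [&& o S1, o S2 & o S3] && [|| o S1, o S2 | o S3]].
Proof.
(* The passage of [t] that meets [next t] is the second one if its partner lies there, and otherwise
   the first. *)
pose y t := other (P t true) \in [:: P (next t) false; P (next t) true].
have inP t b : P t b \in [:: P t false; P t true] by case: b; rewrite !inE eqxx ?orbT.
have yP t : exists c, other (P t (y t)) = P (next t) c.
  rewrite /y; have [|yt] := boolP (_ \in _).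
    by rewrite !inE => /orP [] /eqP ->; [exists false | exists true].
  have [t1 n1 [e1 _]] := mate t true; have [t0 n0 [e0 _]] := mate t false.
  case: (third n0) => t0e; first by rewrite -t0e e0; eexists.
  case: (third n1) => t1e; first by move: yt; rewrite e1 t1e inP.
  by case: (not_both n0 e0 (c' := ~~ (s t == eps (P t true)))); rewrite e1 t1e t0e.
have next_neq t : next t <> t by case: t.
have next2_neq t : next (next t) <> t by case: t.
have oP t : other (P t (y t)) = P (next t) (~~ y (next t)).
  have [c e] := yP t; rewrite e; congr P.
  have : c <> y (next t).
    move=> ce; have [c' e'] := yP (next t).
    by move: e'; rewrite -ce -e otherK => /P_inj [/esym /next2_neq].
  by case: (c); case: (y _).
exists y => e o; split=> //.
- move=> t; have [t' _ [ot _]] := mate t (y t); move: ot.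
  rewrite oP => /P_inj [_]; rewrite -/(e t).
  by case: (y (next t)); case: (s t); case: (e t).
- move=> t; have [t' _ [ot st]] := mate t (y t); move: ot.
  by rewrite oP => /P_inj [-> _].
have o_other t : over (P (next t) (~~ y (next t))) = ~~ o t.
  by rewrite -oP /o; case: (P t (y t)).
have oE t b : over (P (next t) b) = if b == y (next t) then o (next t) else ~~ o t.
  case: eqP => [->//|be]; rewrite -o_other; congr (over (P _ _)).
  by case: b be; case: (y _).
(* A strand [t] that is over twice has [o t] true, while the strand before it, [next (next t)], goes
   under it; so [o] takes both values. *)
have [t1 [a1 b1]] : exists t, o (next t) = true /\ o t = false.
  have [t h] := overP; exists (next (next t)).
  move: h; rewrite -{1 2}(next3 t) !oE next3.
  by case: (y t) => /= /andP []; case: (o t); case: (o _).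
by apply/andP; split; case: t1 a1 b1 => /= -> ->; rewrite ?orbT ?andbF.
Qed.

End Mates.

(** * Positions in the code of a triangle *)

Definition triangle_code (w0 w1 w2 w3 : code) (p1 p2 q1 q2 r1 r2 : passage) : code :=
  w0 ++ [:: p1; p2] ++ w1 ++ [:: q1; q2] ++ w2 ++ [:: r1; r2] ++ w3.

Section Concrete.
Variables w0 w1 w2 w3 : code.

Definition strand_pos t := match t with
  | S1 => size w0
  | S2 => (size w0 + size w1).+2
  | S3 => (size w0 + size w1 + size w2).+4 end.

Lemma triangle_code_split p1 p2 q1 q2 r1 r2 t : exists u v,
  triangle_code w0 w1 w2 w3 p1 p2 q1 q2 r1 r2 =
    u ++ match t with
         | S1 => [:: p1; p2] | S2 => [:: q1; q2] | S3 => [:: r1; r2] end ++ v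
  /\ size u = strand_pos t.
Proof.
rewrite /triangle_code; case: t.
- by exists w0; eexists.
- exists (w0 ++ [:: p1; p2] ++ w1); eexists; split; first by rewrite -!catA.
  by rewrite !size_cat /= !addnS.
- exists (w0 ++ [:: p1; p2] ++ w1 ++ [:: q1; q2] ++ w2); eexists.
  split; first by rewrite -!catA.
  by rewrite !size_cat /= !addnS -?addnA.
Qed.

Lemma perm_triangle_code p1 p2 q1 q2 r1 r2 :
  perm_eq [:: p1, p2, q1, q2, r1, r2 & w0 ++ w1 ++ w2 ++ w3]
    (triangle_code w0 w1 w2 w3 p1 p2 q1 q2 r1 r2).
Proof.
by apply/permP => p; rewrite /triangle_code /= !count_cat /= !count_cat /=
  !count_cat /=; lia.
Qed.

Lemma index_triangle_code p1 p2 q1 q2 r1 r2 p :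
  p \notin [:: p1; p2] -> p \notin [:: q1; q2] -> p \notin [:: r1; r2] ->
  index p (triangle_code w0 w1 w2 w3 p1 p2 q1 q2 r1 r2) =
  skip (size w0) (skip (size (w0 ++ w1)) (skip (size (w0 ++ w1 ++ w2))
    (index p (w0 ++ w1 ++ w2 ++ w3)))).
Proof.
move=> pP pQ pR; rewrite /triangle_code.
rewrite index_insert //; congr (skip _ _).
have -> : w0 ++ w1 ++ [:: q1; q2] ++ w2 ++ [:: r1; r2] ++ w3 =
  (w0 ++ w1) ++ [:: q1; q2] ++ w2 ++ [:: r1; r2] ++ w3 by rewrite -!catA.
rewrite index_insert //; congr (skip _ _).
have -> : (w0 ++ w1) ++ w2 ++ [:: r1; r2] ++ w3 =
  (w0 ++ w1 ++ w2) ++ [:: r1; r2] ++ w3 by rewrite -!catA.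
by rewrite index_insert // -!catA.
Qed.

End Concrete.

Lemma perm_swap_pairs (T : eqType) (a b c d e f : T) s :
  perm_eq [:: b, a, d, c, f, e & s] [:: a, b, c, d, e, f & s].
Proof. by apply/permP => p /=; lia. Qed.

Lemma strand_pos_inj w0 w1 w2 t t' :
  strand_pos w0 w1 w2 t = strand_pos w0 w1 w2 t' -> t = t'.
Proof. by case: t; case: t' => //=; lia. Qed.

Lemma strand_pos_apart w0 w1 w2 t t' :
  strand_pos w0 w1 w2 t <> (strand_pos w0 w1 w2 t').+1.
Proof. by case: t; case: t' => //=; lia. Qed.

Lemma strand_pos_le w0 w1 w2 w3 p1 p2 q1 q2 r1 r2 t :
  ((strand_pos w0 w1 w2 t).+2 <=
   size (triangle_code w0 w1 w2 w3 p1 p2 q1 q2 r1 r2))%N.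
Proof. by rewrite /triangle_code !size_cat /=; case: t => /=; lia. Qed.

Lemma mock_RIII (K K' : knotoid_diagram) :
  RIII K K' -> mock_alexander K = mock_alexander K'.
Proof.
case: K K' => w gw sw [w' gw' sw'] /= [w0 [w1 [w2 [w3 [p1 [p2 [q1 [q2 [r1 [r2
  [s [t [u]]]]]]]]]]]]] /=.
rewrite /mock_alexander /= !addnS !addn0 => -[ew top _ xyz ew'].
pose n := strand_pos w0 w1 w2.
pose side t0 := match t0 with S1 => s | S2 => t | S3 => u end.
pose P t0 (b : bool) := match t0 with
  | S1 => if b then p2 else p1 | S2 => if b then q2 else q1
  | S3 => if b then r2 else r1 end.
have {}ew : w = triangle_code w0 w1 w2 w3 p1 p2 q1 q2 r1 r2 by [].
have {}ew' : w' = triangle_code w0 w1 w2 w3 p2 p1 q2 q1 r2 r1 by [].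
have wP t0 : exists u0 v0, w = u0 ++ [:: P t0 false; P t0 true] ++ v0 /\ size u0 = n t0.
  by rewrite ew; have := triangle_code_split w0 w1 w2 w3 p1 p2 q1 q2 r1 r2 t0; case: t0.
have wP' t0 : exists u0 v0,
    w' = u0 ++ [:: P t0 true; P t0 false] ++ v0 /\ size u0 = n t0.
  by rewrite ew'; have := triangle_code_split w0 w1 w2 w3 p2 p1 q2 q1 r2 r1 t0; case: t0.
have n_inj t0 t1 : n t0 = n t1 -> t0 = t1 by apply: strand_pos_inj.
have n_apart t0 t1 : n t0 <> (n t1).+1 by apply: strand_pos_apart.
have n_le t0 : ((n t0).+2 <= size w)%N by rewrite ew; apply: strand_pos_le.
pose d := region_of (mk_side w (size w0).+1 s).
have face (m : nat * bool) : (m.1 <= size w)%N ->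
    rho w m = d <-> exists t0, m = ((n t0).+1, side t0).
  pose M := [seq ((n t0).+1, side t0) | t0 <- [:: S1; S2; S3]].
  have Mw : all (fun m => m.1 <= size w)%N M.
    apply/allP => m'; rewrite !inE => /or3P [] /eqP ->.
    - exact: ltnW (n_le S1).
    - exact: ltnW (n_le S2).
    - exact: ltnW (n_le S3).
  have xM : d = [set z in [seq mk_side w m.1 m.2 | m <- M]].
    by rewrite /d xyz; apply/setP => z; rewrite !inE orbA.
  move=> mw; have fE := rho_face Mw xM mw; split=> [/eqP|[t0 mt]].
    rewrite fE !inE => /or3P [] /eqP ->; [exists S1 | exists S2 | exists S3];
    done.
  by apply/eqP; rewrite fE mt !inE; case: t0 {mt}; rewrite eqxx ?orbT.
have overP : exists t0, over (P t0 false) && over (P t0 true).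
  by case/or3P: top => h; [exists S1 | exists S2 | exists S3].
have [y [oP se se' o_layered]] :=
  triangle_mates gw wP n_inj n_apart n_le face overP.
pose rest := w0 ++ w1 ++ w2 ++ w3.
have pw : perm_eq [:: P S1 false, P S1 true, P S2 false, P S2 true,
    P S3 false, P S3 true & rest] w.
  by rewrite ew; apply: perm_triangle_code.
have pw' : perm_eq w' w.
  apply: perm_trans pw; rewrite perm_sym ew'.
  apply: perm_trans (perm_triangle_code w0 w1 w2 w3 p2 p1 q2 q1 r2 r1).
  exact: perm_swap_pairs.
have iP t0 b : index (P t0 b) w = (n t0 + b)%N.
  exact: (index_strands gw wP).
(* The code [w'] has the same shape as [w] with the two passages of each strand exchanged, so the
   same computation gives the reversed positions. *)
have iP' t0 b : index (P t0 b) w' = (n t0 + ~~ b)%N.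
  by have := index_strands gw' (P := fun t1 b1 => P t1 (~~ b1)) wP' t0 (~~ b);
    rewrite negbK.
have irest : {in rest, forall q, index q w' = index q w}.
  move=> q qr; have : q \notin [:: p1; p2; q1; q2; r1; r2].
    have : uniq ([:: p1; p2; q1; q2; r1; r2] ++ rest).
      by rewrite (perm_uniq pw) gauss_uniq.
    by rewrite cat_uniq => /and3P [_ /hasPn /(_ q qr)].
  rewrite !inE !negb_or => /and5P [h1 h2 h3 h4 /andP [h5 h6]].
  by rewrite ew ew' !index_triangle_code // !inE !negb_or ?h1 ?h2 ?h3 ?h4 ?h5 ?h6.
apply: (nabla_triangle gw sw gw' sw' (perm_size pw') pw pw' iP iP' irest
  n_inj n_apart n_le _ face oP se se' o_layered).
exact: region_of_regions.
Qed.

Theorem proposition5 (K K' : knotoid_diagram) (h : equivalent K K') :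
  mock_alexander K = mock_alexander K'.
Proof.
elim: h => {K K'} [K K' [] | // | K K' _ -> // | K1 K2 K3 _ -> _ -> //].
- exact: mock_isotopic.
- exact: mock_RI.
- exact: mock_RII.
- exact: mock_RIII.
Qed.
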